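(* Let $(\mu^{(0)},(\mu^{(1)},r^{(1)}),\dots,(\mu^{(n)},r^{(n)}))$ be a rigged configuration for $A^{(1)}_n$ with $\mu^{(0)}=(\mu^{(0)}_1,\dots,\mu^{(0)}_L)$, and let $p_1\otimes\cdots\otimes p_L\in B_{\mu^{(0)}_1}\otimes\cdots\otimes B_{\mu^{(0)}_L}$ be its image under the KKR map. Then for every $1\le k\le L$, writing $p_k=(x_1,\dots,x_{n+1})$, one has for every $1\le d\le n+1$ $$x_d=\tau_{k,d}-\tau_{k-1,d}-\tau_{k,d-1}+\tau_{k-1,d-1},$$ where $\tau_{k,d}$ are the ultradiscrete tau functions of this rigged configuration.
   Context: Fix $n\ge1$. For $l\ge1$ let $B_l=\{x=(x_1,\dots,x_{n+1})\in\mathbb Z_{\ge0}^{n+1}: x_1+\cdots+x_{n+1}=l\}$ (an element $x$ is also viewed as a one-row semistandard tableau with $x_i$ letters $i$). Notation: for finite multisets (or sequences) of positive integers $\lambda=(\lambda_1,\dots,\lambda_k)$, $\mu=(\mu_1,\dots,\mu_m)$ write $|\lambda|=\sum_i\lambda_i$, $\lambda_{[N]}=(\lambda_1,\dots,\lambda_N)$ ($\lambda_{[0]}=\emptyset$), $\min(\lambda,\mu)=\sum_{i=1}^k\sum_{j=1}^m\min(\lambda_i,\mu_j)$, and $\lambda\subseteq\mu$ means inclusion of multisets (with multiplicity). Rigged configuration: data $(\mu^{(0)},(\mu^{(1)},r^{(1)}),\dots,(\mu^{(n)},r^{(n)}))$ where $\mu^{(0)}=(\mu^{(0)}_1,\dots,\mu^{(0)}_L)$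 is a sequence of positive integers and, for $1\le a\le n$, $(\mu^{(a)},r^{(a)})$ is a finite multiset of pairs $(\mu^{(a)}_i,r^{(a)}_i)$ (row length $\mu^{(a)}_i\in\mathbb Z_{\ge1}$, rigging $r^{(a)}_i\in\mathbb Z$) such that $0\le r^{(a)}_i\le p^{(a)}_{\mu^{(a)}_i}$, where the vacancy numbers are $p^{(a)}_j=E^{(a-1)}_j-2E^{(a)}_j+E^{(a+1)}_j$ with $E^{(a)}_j=\sum_k\min(j,\mu^{(a)}_k)$ for $0\le a\le n$ and $E^{(n+1)}_j=0$. Tau functions: for $\lambda\subseteq\mu^{(0)}$ and $1\le d\le n+1$, $$\tau_d(\lambda)=\max\Big\{\min(\lambda,\nu^{(1)})+\sum_{a=1}^{n-1}\min(\nu^{(a)},\nu^{(a+1)})-\sum_{a=1}^{n}\min(\nu^{(a)},\nu^{(a)})-\sum_{a=1}^n|s^{(a)}|-|\nu^{(d)}|\Big\},$$ the maximum being over all independent choices, for each $1\le a\le n$, of a sub-multiset of pairs $\{(\nu^{(a)}_i,s^{(a)}_i)\}\subseteq\{(\mu^{(a)}_i,r^{(a)}_i)\}$ (with $\nu^{(a)}$ the chosen lengths and $s^{(a)}$ the chosen riggings), and with the convention $|\nu^{(n+1)}|=0$; also $\tau_0(\lambda)=\tau_{n+1}(\lambda)-|\lambda|$. Set $\tau_{k,d}=\tau_d(\mu^{(0)}_{[k]})$ for $0\le k\le L$, $0\le d\le n+1$. KKR map: it sends such a rigged configuration to $p_1\otimes\cdots\otimes p_L\in B_{\mu^{(0)}_1}\otimes\cdots\otimes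 B_{\mu^{(0)}_L}$ as follows. One performs elementary steps, each removing one box from the row of $\mu^{(0)}$ currently processed and outputting a letter in $\{1,\dots,n+1\}$; the rows $\mu^{(0)}_L,\mu^{(0)}_{L-1},\dots,\mu^{(0)}_1$ are processed in this order, each until empty, and $p_k=(x_1,\dots,x_{n+1})$ with $x_j$ the number of steps during the processing of row $\mu^{(0)}_k$ that output $j$. Elementary step: let $\ell_0$ be the current length of the processed row of $\mu^{(0)}$. For $i=1,2,\dots,n$ in turn, look at the rows of $\mu^{(i)}$ of length $\ge\ell_{i-1}$ that are singular (rigging equal to the current vacancy number $p^{(i)}_\ell$ of its length $\ell$); if some exist choose one of minimal length and call its length $\ell_i$; otherwise stop. Let $j-1$ be the number of rows chosen (so $j\in\{1,\dots,n+1\}$); output $j$. Then remove the last box of the processed row of $\mu^{(0)}$ and of each chosen row in $\mu^{(1)},\dots,\mu^{(j-1)}$ (rows of length $0$ are discarded), recompute all vacancy numbers from the new configuration (including the shortened $\mu^{(0)}$), give each shortened row of $\mu^{(1)},\dots,\mu^{(n)}$ the new vacancy number of its new length as rigging, and keep the riggings of all other rows. (The result does not depend on choices among rows of equal length.) *)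

(* Defs.v *)
From mathcomp Require Import all_boot all_order all_algebra.
Local Open Scope ring_scope.
Set Implicit Arguments. Unset Strict Implicit. Unset Printing Implicit Defensive.
Import Order.TTheory GRing.Theory Num.Theory.

(* A configuration (mu^(1), r^(1)), ..., (mu^(n), r^(n)) is represented by
   [cfg : seq (seq (nat * int))] of size n; [nth [::] cfg (a-1)] is the
   multiset (as a list, order irrelevant) of pairs (row length, rigging)
   of (mu^(a), r^(a)).  mu^(0) is [mu0 : seq nat]. *)
Definition config := seq (seq (nat * int)).

(* the (row lengths of the) a-th partition, 1 <= a; empty for a > size cfg *)
Definition lens (cfg : config) (a : nat) : seq nat :=
  [seq x.1 | x <- nth [::] cfg a.-1].

(* E^{(b)}_j, with E^{(0)} computed from mu0 and E^{(n+1)} = 0 *)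
Definition Ef (mu0 : seq nat) (cfg : config) (b j : nat) : int :=
  if b == 0 then Posz (sumn [seq minn j m | m <- mu0])
  else Posz (sumn [seq minn j m | m <- lens cfg b]).

Definition vac (mu0 : seq nat) (cfg : config) (a j : nat) : int :=
  (Ef mu0 cfg a.-1 j - 2%:Z * Ef mu0 cfg a j + Ef mu0 cfg a.+1 j)%R.

Definition is_RC (n : nat) (mu0 : seq nat) (cfg : config) : Prop :=
  [/\ size cfg = n,
      all (fun m => 0 < m)%N mu0 &
      forall a, (1 <= a <= n)%N -> forall x, x \in nth [::] cfg a.-1 ->
        [/\ (0 < x.1)%N, (0 <= x.2)%R & (x.2 <= vac mu0 cfg a x.1)%R]].

Definition minp (l m : seq nat) : int :=
  Posz (sumn [seq sumn [seq minn i j | j <- m] | i <- l]).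

Definition isum (s : seq int) : int := foldr (fun x y => x + y) 0 s.

Fixpoint subseqs (T : Type) (s : seq T) : seq (seq T) :=
  if s is x :: s' then
    let r := subseqs s' in [seq x :: t | t <- r] ++ r
  else [:: [::]].

Fixpoint all_choices (T : Type) (cs : seq (seq T)) : seq (seq (seq T)) :=
  if cs is c :: cs' then
    [seq t :: u | t <- subseqs c, u <- all_choices cs']
  else [:: [::]].

(* the quantity maximized in tau_d(lambda), for a choice nu (size n);
   |nu^{(n+1)}| = 0 holds automatically as [lens nu (n+1) = [::]] *)
Definition tau_val (n : nat) (lam : seq nat) (nu : config) (d : nat) : int :=
  (minp lam (lens nu 1)
   + isum [seq minp (lens nu a) (lens nu a.+1) | a <- iota 1 n.-1]
   - isum [seq minp (lens nu a) (lens nu a) | a <- iota 1 n]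
   - isum [seq isum [seq x.2 | x <- nth [::] nu a.-1] | a <- iota 1 n]
   - Posz (sumn (lens nu d)))%R.

(* tau_d(lambda) for 1 <= d <= n+1 (the maximum over all choices; the
   all-empty choice is among them) *)
Definition tau (n : nat) (cfg : config) (lam : seq nat) (d : nat) : int :=
  foldr Num.max (tau_val n lam (nseq n [::]) d)
        [seq tau_val n lam nu d | nu <- all_choices cfg].

Definition tau_kd (n : nat) (mu0 : seq nat) (cfg : config) (k d : nat) : int :=
  if d == 0 then (tau n cfg (take k mu0) n.+1 - Posz (sumn (take k mu0)))%R
  else tau n cfg (take k mu0) d.

Fixpoint choose_rows (mu0 : seq nat) (cfg : config) (i k lprev : nat) : seq nat :=
  match k with
  | 0 => [::]
  | k'.+1 =>
    let cands := [seq x.1 | x <- nth [::] cfg i.-1 &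
                   (lprev <= x.1)%N && (x.2 == vac mu0 cfg i x.1)] in
    if cands is c :: cs then
      let l := foldr minn c cs in l :: choose_rows mu0 cfg i.+1 k' l
    else [::]
  end.

(* state: current mu0 (last entry = row being processed) and configuration *)
Definition kkr_state := (seq nat * config)%type.

Definition kkr_step (n : nat) (st : kkr_state) : nat * kkr_state :=
  let: (mu0, cfg) := st in
  let l0 := last 0 mu0 in
  let ch := choose_rows mu0 cfg 1 n l0 in
  let pre := take (size mu0).-1 mu0 in
  let mu0' := if l0.-1 == 0 then pre else rcons pre l0.-1 in
  let removed i := rem (nth 0 ch i, vac mu0 cfg i.+1 (nth 0 ch i)) (nth [::] cfg i) in
  (* configuration with shortened rows (rigging placeholder); only used for
     the new vacancy numbers, which depend only on the row lengths *)
  let cfg_tmp := mkseq (fun i =>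
       if (i < size ch)%N then rcons (removed i) ((nth 0 ch i).-1, 0%:Z)
       else nth [::] cfg i) (size cfg) in
  let cfg' := mkseq (fun i =>
       if (i < size ch)%N then
         let l := (nth 0 ch i).-1 in
         if l == 0 then removed i
         else rcons (removed i) (l, vac mu0' cfg_tmp i.+1 l)
       else nth [::] cfg i) (size cfg) in
  ((size ch).+1, (mu0', cfg')).

Fixpoint kkr_run (n m : nat) (st : kkr_state) : seq nat * kkr_state :=
  match m with
  | 0 => ([::], st)
  | m'.+1 =>
    let: (j, st') := kkr_step n st in
    let: (js, st'') := kkr_run n m' st' in (j :: js, st'')
  end.

(* letters output while processing rows L, L-1, ..., 1; result listed as
   rows 1..L *)
Fixpoint kkr_letters (n L : nat) (st : kkr_state) : seq (seq nat) :=
  match L with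
  | 0 => [::]
  | L'.+1 =>
    let: (ls, st') := kkr_run n (last 0 st.1) st in
    rcons (kkr_letters n L' st') ls
  end.

Definition KKR (n : nat) (mu0 : seq nat) (cfg : config) : seq (seq nat) :=
  [seq [seq count_mem d ls | d <- iota 1 n.+1]
   | ls <- kkr_letters n (size mu0) (mu0, cfg)].

(* Main.v *)
Require Import Defs.
From mathcomp Require Import all_boot all_order all_algebra.
From mathcomp Require Import zify ring.
Set Implicit Arguments. Unset Strict Implicit. Unset Printing Implicit Defensive.
Import Order.TTheory GRing.Theory Num.Theory.
Local Open Scope ring_scope.

(** Completing squares, the quantity maximized in [tau_d(lambda)] is, up to a
    constant depending only on [lambda], minus the cost of an integral flow
    with convex costs: with [m_a(i)] the number of chosen rows of length at
    least [i] in colour [a] ([m_0] counting [lambda]), column [a] carries the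
    flow [m_a(i) - m_(a+1)(i)] at height [i].  Discrete convexity gives an exact
    integral dual, a minimum over potentials [phi_a(i)] in which every row
    [(l, s)] of colour [a] contributes the positive part of
    [phi_(a-1)(l) - phi_a(l) - s].

    For [lambda = mu0] the potential [E^(a) - E^(a+1)] is optimal, so that
    [tau_(n+1)(mu0) - tau_d(mu0)] is the size of [mu^(d)].  One step of the KKR
    map leaves [tau_d(lambda)] unchanged for every prefix [lambda] avoiding the
    processed row: in the dual only the chosen rows move, and they can be moved
    one colour at a time, each move being compensated by shifting one of the two
    adjacent columns of the potential by one on an interval of heights.  Hence
    [tau_(n+1) - tau_d] at the k-th prefix counts the letters larger than [d] in
    [p_1, ..., p_k]. *)

(* [lia] does not identify sums whose canonical instances differ only up to
   conversion, so they are abstracted first. *)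
Ltac slia :=
  repeat (match goal with |- context [bigop.body ?i ?r ?F] =>
    let S := fresh "S" in set S := (bigop.body i r F); move: S => S end);
  intros; lia.

(** * Positive parts, triangular numbers and discretely convex functions of potentials *)

Definition pos (x : int) : int := Num.max x 0.

Lemma pos_ge0 x : 0 <= pos x. Proof. rewrite /pos; lia. Qed.
Lemma pos_ge x : x <= pos x. Proof. rewrite /pos; lia. Qed.

Lemma sum_subseqs_le_pos (T : eqType) (F : T -> int) (s t : seq T) :
  t \in subseqs s -> \sum_(x <- t) F x <= \sum_(x <- s) pos (F x).
Proof.
elim: s t => [|y s IHs] t /=; first by rewrite mem_seq1 => /eqP ->; rewrite !big_nil.
rewrite mem_cat => /orP[/mapP[v vin ->]|tin]; rewrite !big_cons.
  by apply: lerD; [exact: pos_ge | exact: IHs].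
by apply: le_trans (IHs _ tin) _; rewrite lerDr pos_ge0.
Qed.

(** The convex cost of a potential increment; the division is exact, [k * (k + 1)] being even. *)
Definition tri (k : int) : int := divz (k * (k + 1)) 2.

Lemma triE k : 2 * tri k = k * (k + 1).
Proof.
rewrite /tri; have := divz_eq k 2.
have := modz_ge0 k (isT : (2 : int) != 0).
have := ltz_mod k (isT : (2 : int) != 0).
set m := divz k 2; set r := modz k 2 => r2 r0 ->.
have [->|->] : r = 0 \/ r = 1 by slia.
  have -> : (m * 2 + 0) * (m * 2 + 0 + 1) = (m * (m * 2 + 1)) * 2 :> int by ring.
  by rewrite mulzK // mulrC.
have -> : (m * 2 + 1) * (m * 2 + 1 + 1) = ((m * 2 + 1) * (m + 1)) * 2 :> int by ring.
by rewrite mulzK // mulrC.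
Qed.

(* [phi a i] is the potential of column [a] at height [i]; height 0 is grounded
   by [ev], whatever the value of [phi a 0]. *)
Definition pot := nat -> nat -> int.

Definition ev (phi : pot) (a i : nat) : int := if i is 0 then 0 else phi a i.

(** [lo] is the minimum of [phi] and [psi + al], [hi] the maximum of [psi] and [phi - al]; [al >= 0]
    makes these formulas compatible with the grounded height 0. *)
Definition lo (phi psi : pot) (al : int) : pot :=
  fun a i => phi a i - pos (phi a i - psi a i - al).
Definition hi (phi psi : pot) (al : int) : pot :=
  fun a i => psi a i + pos (phi a i - psi a i - al).

Lemma ev_lo phi psi al a i : 0 <= al ->
  ev (lo phi psi al) a i = ev phi a i - pos (ev phi a i - ev psi a i - al).
Proof. by case: i => [|i] //= al0; rewrite /pos; slia. Qed.

Lemma ev_hi phi psi al a i : 0 <= al ->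
  ev (hi phi psi al) a i = ev psi a i + pos (ev phi a i - ev psi a i - al).
Proof. by case: i => [|i] //= al0; rewrite /pos; slia. Qed.

(* L-natural convexity in the sense of Murota (translation submodularity). *)
Definition Lconv (f : pot -> int) :=
  forall phi psi al, 0 <= al ->
    f (lo phi psi al) + f (hi phi psi al) <= f phi + f psi.

Lemma Lconv_add f g : Lconv f -> Lconv g -> Lconv (fun phi => f phi + g phi).
Proof.
by move=> cf cg phi psi al al0; move: (cf phi psi al al0) (cg phi psi al al0); slia.
Qed.

Lemma Lconv_sum (I : Type) (r : seq I) (F : I -> pot -> int) :
  (forall i, Lconv (F i)) -> Lconv (fun phi => \sum_(i <- r) F i phi).
Proof.
by move=> cF phi psi al al0; rewrite -!big_split; apply: ler_sum => i _; apply: cF.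
Qed.

(** The hypothesis on [h] is discrete convexity: [x - e] and [y + e] lie between [x] and [y] and
    have the same sum. Passing to [lo] and [hi] moves the difference by [e1 - e2], which lies
    between 0 and the gap of the two differences. *)
Lemma Lconv_diff (h : int -> int) a i b j :
  (forall x y e, 0 <= e * (x - y - e) -> h (x - e) + h (y + e) <= h x + h y) ->
  Lconv (fun phi => h (ev phi a i - ev phi b j)).
Proof.
move=> ch phi psi al al0; rewrite !ev_lo // !ev_hi //.
set x1 := ev phi a i; set x2 := ev phi b j; set y1 := ev psi a i; set y2 := ev psi b j.
set e1 := pos (x1 - y1 - al); set e2 := pos (x2 - y2 - al).
have -> : x1 - e1 - (x2 - e2) = (x1 - x2) - (e1 - e2) by ring.
have -> : y1 + e1 - (y2 + e2) = (y1 - y2) + (e1 - e2) by ring.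
apply: ch.
have : (0 <= e1 - e2 /\ 0 <= x1 - x2 - (y1 - y2) - (e1 - e2)) \/
       (e1 - e2 <= 0 /\ x1 - x2 - (y1 - y2) - (e1 - e2) <= 0).
  rewrite /e1 /e2 /pos; slia.
case=> [[h1 h2]|[h1 h2]]; first exact: mulr_ge0.
exact: mulr_le0.
Qed.

(** * Integral minimax for sums of positive parts *)

(** Excess of the potential drop across a row over its rigging. The row has colour [a.+1]: colours
    are numbered from 1, columns from 0. *)
Definition qe (a : nat) (x : nat * int) (phi : pot) : int :=
  ev phi a x.1 - ev phi a.+1 x.1 - x.2.

Lemma Lconv_qe a x : Lconv (qe a x).
Proof.
apply: (@Lconv_diff (fun z => z - x.2)) => u v e _; slia.
Qed.

Lemma Lconv_pos_qe a x : Lconv (fun phi => pos (qe a x phi)).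
Proof.
apply: (@Lconv_diff (fun z => pos (z - x.2))) => u v e h; rewrite /pos.
have : (0 <= e /\ e <= u - v) \/ (e <= 0 /\ u - v <= e) by nia.
slia.
Qed.

Lemma qe_exchange f a x phi psi : Lconv f -> qe a x psi + 2 <= qe a x phi ->
  exists phi' psi', [/\ qe a x phi' = qe a x phi - 1, qe a x psi' = qe a x psi + 1 &
    f phi' + f psi' <= f phi + f psi].
Proof.
move=> cf; rewrite /qe.
set A := ev phi a x.1; set A' := ev phi a.+1 x.1.
set B := ev psi a x.1; set B' := ev psi a.+1 x.1 => gap.
(* If column [a] of [phi] is above that of [psi], the shift [A - B - 1] moves it by exactly 1 and
   leaves column [a.+1] alone at height [x.1]. Otherwise the gap of 2 puts column [a.+1] of [psi]
   above that of [phi], and the roles are exchanged. *)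
have [h|h] := lerP 1 (A - B).
  have al0 : 0 <= A - B - 1 by slia.
  exists (lo phi psi (A - B - 1)), (hi phi psi (A - B - 1)).
  rewrite !ev_lo // !ev_hi // -/A -/A' -/B -/B'; split; last exact: cf.
  - by rewrite /pos; slia.
  - by rewrite /pos; slia.
have al0 : 0 <= B' - A' - 1 by slia.
exists (hi psi phi (B' - A' - 1)), (lo psi phi (B' - A' - 1)).
rewrite !ev_lo // !ev_hi // -/A -/A' -/B -/B'; split.
- by rewrite /pos; slia.
- by rewrite /pos; slia.
- by move: (cf psi phi _ al0); slia.
Qed.

(* Exchanging [phi] and [psi] brings [qe phi] and [qe psi] one closer to each
   other and keeps one of the two a minimizer, until some [qe] reaches 0. *)
Lemma min_pos_qe f a x phi psi : Lconv f ->
  (forall u, f phi <= f u) -> (forall u, f psi + qe a x psi <= f u + qe a x u) ->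
  exists u, f u + pos (qe a x u) <= f phi \/ f u + pos (qe a x u) <= f psi + qe a x psi.
Proof.
move=> cf; have [N] := ubnP `|qe a x phi - qe a x psi|%N.
elim: N phi psi => // N IH phi psi ltN min0 min1.
have [h0|h0] := lerP (qe a x phi) 0; first by exists phi; left; rewrite /pos; slia.
have [h1|h1] := lerP 0 (qe a x psi); first by exists psi; right; rewrite /pos; slia.
have gap : qe a x psi + 2 <= qe a x phi by slia.
have [phi' [psi' [e0 e1 le]]] := qe_exchange cf gap.
have [eq0|ne0] := lerP (f phi') (f phi).
  have eqf : f phi' = f phi by move: (min0 phi'); slia.
  have [||u] := IH phi' psi _ _ min1; [lia|by move=> u; rewrite eqf|].
  by rewrite eqf => hu; exists u.
have le1 : f psi' + qe a x psi' <= f psi + qe a x psi by slia.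
have [||u] := IH phi psi' _ min0; [lia| |].
  by move=> u; apply: le_trans le1 _.
case=> hu; exists u; [by left|right; exact: le_trans hu le1].
Qed.

(** Some choice [t] reaches the value of the problem with positive parts. The induction is run on
    [f], leaving [x] out, and on [f] plus the term of [x], taking it in; [min_pos_qe] decides
    between the two. *)
Lemma min_pos_seq f a (c : seq (nat * int)) : Lconv f ->
  (forall t, t \in subseqs c ->
     exists phi, forall u, f phi + \sum_(x <- t) qe a x phi <= f u + \sum_(x <- t) qe a x u) ->
  exists2 t, t \in subseqs c & exists phi, forall u,
     f phi + \sum_(x <- c) pos (qe a x phi) <= f u + \sum_(x <- t) qe a x u.
Proof.
elim: c f => [|x c IH] f cf minf.
  have in0 : [::] \in subseqs ([::] : seq (nat * int)) by rewrite mem_seq1.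
  have [phi hphi] := minf _ in0.
  by exists [::] => //; exists phi => u; move: (hphi u); rewrite !big_nil.
have [t tin|t0 t0in [phi0 min0]] := IH f cf.
  by apply: minf; rewrite /= mem_cat tin orbT.
have [|t tin|t1 t1in [phi1 min1]] := IH (fun u => f u + qe a x u).
- exact/Lconv_add/Lconv_qe.
- have [|phi hphi] := minf (x :: t).
    by rewrite /= mem_cat; apply/orP; left; apply/mapP; exists t.
  by exists phi => u; move: (hphi u); rewrite !big_cons !addrA.
pose g u := f u + \sum_(y <- c) pos (qe a y u).
have sub t u := @sum_subseqs_le_pos _ (fun y => qe a y u) c t.
have [||| u hu] := @min_pos_qe g a x phi0 phi1.
- by apply: Lconv_add => //; apply: Lconv_sum => y; apply: Lconv_pos_qe.
- by move=> u; apply: le_trans (min0 u) _; rewrite lerD2l sub.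
- by move=> u; move: (min1 u) (sub _ u t1in); rewrite /g /=; slia.
case: hu => hu.
  exists t0; first by rewrite /= mem_cat t0in orbT.
  by exists u => v; move: (min0 v) hu; rewrite big_cons /g; slia.
exists (x :: t1); first by rewrite /= mem_cat; apply/orP; left; apply/mapP; exists t1.
by exists u => v; move: (min1 v) hu; rewrite !big_cons /g; slia.
Qed.

Fixpoint linq (a : nat) (nu : config) (phi : pot) : int :=
  if nu is c :: nu' then \sum_(x <- c) qe a x phi + linq a.+1 nu' phi else 0.

Fixpoint posq (a : nat) (nu : config) (phi : pot) : int :=
  if nu is c :: nu' then \sum_(x <- c) pos (qe a x phi) + posq a.+1 nu' phi else 0.

Lemma Lconv_posq a nu : Lconv (posq a nu).
Proof.
elim: nu a => [|c nu IH] a /=; first by move=> *.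
apply: Lconv_add => //; apply: Lconv_sum => x; exact: Lconv_pos_qe.
Qed.

Lemma linq_le_posq a cfg nu phi : nu \in all_choices cfg -> linq a nu phi <= posq a cfg phi.
Proof.
elim: cfg nu a => [|c cfg IH] nu a /=; first by rewrite mem_seq1 => /eqP ->.
case/allpairsP => [[t u] [/= tin uin ->]] /=; apply: lerD; last exact: IH.
exact: sum_subseqs_le_pos.
Qed.

(** For each choice in the first colour the induction settles the later colours; then the rows of
    the first colour are treated with [posq] of the rest absorbed into the convex function. *)
Lemma min_posq f a cfg : Lconv f ->
  (forall nu, nu \in all_choices cfg ->
     exists phi, forall u, f phi + linq a nu phi <= f u + linq a nu u) ->
  exists2 nu, nu \in all_choices cfg & exists phi, forall u,
     f phi + posq a cfg phi <= f u + linq a nu u.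
Proof.
elim: cfg a f => [|c cfg IH] a f cf minf.
  have in0 : [::] \in all_choices ([::] : config) by rewrite mem_seq1.
  by have [phi hphi] := minf _ in0; exists [::] => //; exists phi.
have step t : t \in subseqs c -> exists2 nu, nu \in all_choices cfg & exists phi, forall u,
   f phi + \sum_(x <- t) qe a x phi + posq a.+1 cfg phi
     <= f u + \sum_(x <- t) qe a x u + linq a.+1 nu u.
  move=> tin.
  apply: (IH a.+1 (fun u => f u + \sum_(x <- t) qe a x u)).
    by apply: Lconv_add => //; apply: Lconv_sum => x; apply: Lconv_qe.
  move=> nu nuin; have [|phi hphi] := minf (t :: nu).
    by apply/allpairsP; exists (t, nu).
  by exists phi => u; move: (hphi u) => /=; slia.
have [||t tin [phi hphi]] := @min_pos_seq (fun u => f u + posq a.+1 cfg u) a c.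
- by apply: Lconv_add => //; apply: Lconv_posq.
- move=> t /step[nu nuin [phi hphi]]; exists phi => u.
  by move: (hphi u) (linq_le_posq a.+1 u nuin); slia.
have [nu nuin [psi hpsi]] := step t tin.
exists (t :: nu); first by apply/allpairsP; exists (t, nu).
by exists phi => u /=; move: (hphi psi) (hpsi u); slia.
Qed.

(** * Flow form of the maximized quantity *)

Definition dk (phi : pot) (a i : nat) : int := ev phi a i - ev phi a i.-1.

(** The parts of the conjugate partition. *)
Definition cnt (l : seq nat) (i : nat) : int := Posz (count (leq i) l).

(** [M] is to bound all row lengths; the linear term on the columns [a >= d] accounts for the size
    of the [d]-th partition. *)
Definition base (n M d : nat) (lam : seq nat) (phi : pot) : int :=
  \sum_(a < n.+1) \sum_(1 <= i < M.+1)
     (tri (dk phi a i) - Posz (d <= a)%N * dk phi a i)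
  - \sum_(x <- lam) ev phi 0 x.

Lemma Lconv_base n M d lam : Lconv (base n M d lam).
Proof.
rewrite /base; apply: Lconv_add.
  apply: Lconv_sum => a; apply: Lconv_sum => i.
  apply: (@Lconv_diff (fun z => tri z - Posz (d <= a)%N * z)) => x y e h.
  have := triE (x - e); have := triE (y + e); have := triE x; have := triE y; nia.
have cs : Lconv (fun phi => \sum_(x <- lam) - ev phi 0 x).
  by apply: Lconv_sum => x phi psi al al0; rewrite ev_lo // ev_hi //; lia.
by move=> phi psi al al0; move: (cs phi psi al al0); rewrite !sumrN.
Qed.

(** Summation by parts in the height: [ev phi a x] telescopes into the increments up to [x]. *)
Lemma sum_ev (phi : pot) a M (l : seq nat) : all (fun x => x <= M)%N l ->
  \sum_(x <- l) ev phi a x = \sum_(1 <= i < M.+1) dk phi a i * cnt l i.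
Proof.
elim: l => [|x l IH] /=; first by rewrite big_nil big1 // => i _; rewrite mulr0.
case/andP=> xM lM; rewrite big_cons IH //.
have -> : ev phi a x = \sum_(1 <= i < M.+1) dk phi a i * Posz (i <= x)%N.
  rewrite (@big_cat_nat _ _ _ x.+1) //= [X in _ + X]big1_seq ?addr0; last first.
    by move=> i /andP[_]; rewrite mem_index_iota => /andP[h _]; rewrite leqNgt h mulr0.
  rewrite big_nat (eq_bigr (fun i => dk phi a i)); last first.
    by move=> i /andP[_ h]; rewrite -ltnS h mulr1.
  rewrite -big_nat; elim: (x) => [|y IHy]; first by rewrite big_geq.
  by rewrite big_nat_recr //= -IHy /dk /= addrC subrK.
rewrite -big_split; apply: eq_bigr => i _ /=.
by rewrite /cnt /= PoszD; ring.
Qed.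

Lemma linqE a nu phi :
  linq a nu phi = \sum_(b < size nu) \sum_(x <- nth [::] nu b) qe (a + b) x phi.
Proof.
elim: nu a => [|c nu IH] a; first by rewrite big_ord0.
rewrite /= big_ord_recl /= addn0 IH; congr (_ + _); apply: eq_bigr => b _.
by rewrite addSnnS.
Qed.

Lemma posqE a nu phi :
  posq a nu phi = \sum_(b < size nu) \sum_(x <- nth [::] nu b) pos (qe (a + b) x phi).
Proof.
elim: nu a => [|c nu IH] a; first by rewrite big_ord0.
rewrite /= big_ord_recl /= addn0 IH; congr (_ + _); apply: eq_bigr => b _.
by rewrite addSnnS.
Qed.

(* Index 0 stands for [lam]: colour [a] leaves column [a - 1] and enters column [a]. *)
Definition parts (lam : seq nat) (nu : config) (a : nat) : seq nat :=
  if a == 0 then lam else lens nu a.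

(* The flow carried by column [a] at height [i]. *)
Definition ych lam nu a i : int := cnt (parts lam nu a) i - cnt (parts lam nu a.+1) i.

Definition rigs (n : nat) (nu : config) : int :=
  \sum_(a < n) \sum_(x <- nth [::] nu a) x.2.

Definition bounded (M : nat) (nu : config) :=
  forall a, all (fun x => x <= M)%N [seq x.1 | x <- nth [::] nu a].

Lemma abel_cols n (k m : nat -> int) :
  - (k 0%N * m 0%N) + \sum_(a < n) (k a - k a.+1) * m a.+1 =
  - (\sum_(a < n) k a * (m a - m a.+1)) - k n * m n.
Proof.
elim: n => [|n IH]; first by rewrite !big_ord0; ring.
rewrite !big_ord_recr /= addrA IH; ring.
Qed.

(** Summing by parts in the height and in the colour decouples the problem: the increment
    [dk phi a i] meets only the flow [ych lam nu a i]. *)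
Lemma base_linq n M d lam nu phi : size nu = n ->
  all (fun x => x <= M)%N lam -> bounded M nu ->
  base n M d lam phi + linq 0 nu phi =
  \sum_(a < n.+1) \sum_(1 <= i < M.+1)
     (tri (dk phi a i) - Posz (d <= a)%N * dk phi a i - dk phi a i * ych lam nu a i)
  - rigs n nu.
Proof.
move=> sz lamM nuM; rewrite linqE sz /base /rigs /qe.
have -> : \sum_(b < n) \sum_(x <- nth [::] nu b)
       (ev phi (0 + b) x.1 - ev phi (0 + b).+1 x.1 - x.2) =
  \sum_(b < n) \sum_(1 <= i < M.+1) (dk phi b i - dk phi b.+1 i) * cnt (parts lam nu b.+1) i
  - \sum_(b < n) \sum_(x <- nth [::] nu b) x.2.
  rewrite -sumrB; apply: eq_bigr => b _; rewrite sumrB add0n; congr (_ - _).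
  rewrite -(big_map (fun x : nat * int => x.1) xpredT (fun z => ev phi b z - ev phi b.+1 z)).
  rewrite sumrB (@sum_ev _ _ M) // (@sum_ev _ _ M) // -sumrB.
  by apply: eq_bigr => i _; rewrite -mulrBl.
rewrite (sum_ev phi 0 lamM) addrA; congr (_ - _).
rewrite -addrA.
have -> : - (\sum_(1 <= i < M.+1) dk phi 0 i * cnt lam i) +
   \sum_(b < n) \sum_(1 <= i < M.+1) (dk phi b i - dk phi b.+1 i) * cnt (parts lam nu b.+1) i =
   - \sum_(a < n.+1) \sum_(1 <= i < M.+1) dk phi a i * ych lam nu a i.
  rewrite exchange_big /= [in RHS]exchange_big /= -!sumrN -big_split /=.
  apply: eq_bigr => i _.
  rewrite (abel_cols n (fun a => dk phi a i) (fun a => cnt (parts lam nu a) i)) big_ord_recr /=.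
  rewrite opprD; congr (_ + _); rewrite /ych.
  have -> : cnt (parts lam nu n.+1) i = 0 by rewrite /cnt /parts /= /lens /= nth_default // sz.
  by rewrite subr0.
rewrite -sumrB; apply: eq_bigr => a _; rewrite -sumrB; apply: eq_bigr => i _; ring.
Qed.

(** Fenchel's inequality for the cost [tri k - b * k]: a product of two consecutive integers is
    nonnegative. For both values of [b], [k = y] gives equality. *)
Lemma tri_conj (b : bool) k y :
  - tri (y - 1) - Posz b * y <= tri k - Posz b * k - k * y.
Proof.
have := triE (y - 1); have := triE k; case: b => /= h1 h2.
  have : 0 <= (k - y) * (k - y - 1).
    have [?|?] : k - y <= 0 \/ 1 <= k - y by lia.
      by apply: mulr_le0; lia.
    by apply: mulr_ge0; lia.
  by move: h1 h2; lia.
have : 0 <= (k - y) * (k - y + 1).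
  have [?|?] : k - y + 1 <= 0 \/ 0 <= k - y by lia.
    by apply: mulr_le0; lia.
  by apply: mulr_ge0; lia.
lia.
Qed.

Lemma tri_conj_eq (b : bool) y :
  tri y - Posz b * y - y * y = - tri (y - 1) - Posz b * y.
Proof. have := triE (y - 1); have := triE y; lia. Qed.

Lemma sumn_cnt M l : all (fun x => x <= M)%N l ->
  Posz (sumn l) = \sum_(1 <= i < M.+1) cnt l i.
Proof.
(* The potential equal to the height has all increments 1. *)
move=> lM; have := @sum_ev (fun _ i => Posz i) 0 M l lM.
rewrite (eq_big_nat _ _ (F2 := cnt l)) => [<-|[//|i] _]; last first.
  by rewrite /dk; case: i => [|i] /=; rewrite ?subr0 ?mul1r // -[i.+2]addn1 PoszD addrAC subrr add0r mul1r.
elim: (l) => [|x s IH]; rewrite ?big_nil ?big_cons //= PoszD IH; by case: x.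
Qed.

Lemma cnt_cons x l i : cnt (x :: l) i = Posz (i <= x)%N + cnt l i.
Proof. by rewrite /cnt /= PoszD. Qed.

(** [minn i j] counts the heights reached by both rows. *)
Lemma minp_cnt M l m : all (fun x => x <= M)%N l ->
  minp l m = \sum_(1 <= i < M.+1) cnt l i * cnt m i.
Proof.
rewrite /minp; elim: l => [|x l IH] /=; first by rewrite big1 // => i _; rewrite mul0r.
case/andP=> xM lM; rewrite PoszD IH //.
have -> : Posz (sumn [seq minn x j | j <- m]) =
    \sum_(1 <= i < M.+1) Posz (i <= x)%N * cnt m i.
  rewrite (@sumn_cnt M); last first.
    by apply/allP => _ /mapP[z _ ->]; apply: leq_trans (geq_minl _ _) xM.
  apply: eq_bigr => i _; elim: (m) => [|z m' IHm] /=; first by rewrite mulr0.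
  by rewrite !cnt_cons IHm leq_min; case: (i <= x)%N; rewrite /= ?mul1r ?mul0r.
by rewrite -big_split; apply: eq_bigr => i _; rewrite cnt_cons mulrDl.
Qed.

Lemma isumE (s : seq int) : isum s = \sum_(x <- s) x.
Proof. by elim: s => [|x s IH]; rewrite ?big_nil ?big_cons //= IH. Qed.

Lemma isum_iota (F : nat -> int) n : isum [seq F a | a <- iota 1 n] = \sum_(a < n) F a.+1.
Proof.
rewrite isumE big_map (iotaDl 1 0) big_map -[n in iota 0 n]subn0 -/(index_iota 0 n).
by rewrite big_mkord; apply: eq_bigr => a _; rewrite add1n.
Qed.

(** Completing the square: the terms at [a] add up to [tri (m a - 1) - tri (m a.+1 - 1)]. *)
Lemma tri_telescope n (m : nat -> int) :
  \sum_(a < n) (m a * m a.+1 - m a.+1 * m a.+1) + \sum_(a < n) tri (m a - m a.+1 - 1)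
  = tri (m 0%N - 1) - tri (m n - 1).
Proof.
elim: n => [|n IH]; first by rewrite !big_ord0; lia.
rewrite !big_ord_recr /= addrACA IH.
have := triE (m n - m n.+1 - 1); have := triE (m n - 1); have := triE (m n.+1 - 1); lia.
Qed.

Lemma sum_tail d N (m : nat -> int) : (d <= N)%N ->
  \sum_(a < N) Posz (d <= a)%N * (m a - m a.+1) = m d - m N.
Proof.
move/subnKC <-; elim: (N - d)%N => [|k IH].
  rewrite addn0 subrr big1 // => a _.
  by rewrite leqNgt ltn_ord mul0r.
by rewrite addnS big_ord_recr /= IH leq_addr mul1r addrA subrK.
Qed.

(** At each height, completing squares leaves a constant of [lam] and the cost of the last column,
    whose flow is all of colour [n] since colour [n.+1] is empty. The flows of the columns [a >= d]
    telescope to the count of colour [d]. *)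
Lemma tau_valE n M d lam nu : (0 < n)%N -> size nu = n -> (0 < d <= n.+1)%N ->
  all (fun x => x <= M)%N lam -> bounded M nu ->
  tau_val n lam nu d =
  \sum_(a < n.+1) \sum_(1 <= i < M.+1)
     (- tri (ych lam nu a i - 1) - Posz (d <= a)%N * ych lam nu a i)
  - rigs n nu + \sum_(1 <= i < M.+1) tri (cnt lam i - 1).
Proof.
case: n => // n _ sz /andP[d0 dn] lamM nuM.
have partsM a : all (fun x => x <= M)%N (parts lam nu a).
  by rewrite /parts; case: a => //= a; apply: nuM.
pose m a i := cnt (parts lam nu a) i.
have -> : tau_val n.+1 lam nu d =
   \sum_(1 <= i < M.+1) (\sum_(a < n.+1) (m a i * m a.+1 i - m a.+1 i * m a.+1 i) - m d i)
   - rigs n.+1 nu.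
  rewrite /tau_val /rigs.
  have -> : minp lam (lens nu 1) +
      isum [seq minp (lens nu a) (lens nu a.+1) | a <- iota 1 n.+1.-1] =
      \sum_(1 <= i < M.+1) \sum_(a < n.+1) m a i * m a.+1 i.
    rewrite isum_iota exchange_big big_ord_recl /= (@minp_cnt M) //; congr (_ + _).
    by apply: eq_bigr => a _; rewrite (@minp_cnt M) //; apply: (partsM a.+1).
  have -> : isum [seq minp (lens nu a) (lens nu a) | a <- iota 1 n.+1] =
      \sum_(1 <= i < M.+1) \sum_(a < n.+1) m a.+1 i * m a.+1 i.
    rewrite isum_iota exchange_big.
    by apply: eq_bigr => a _; rewrite (@minp_cnt M) //; apply: (partsM a.+1).
  have -> : Posz (sumn (lens nu d)) = \sum_(1 <= i < M.+1) m d i.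
    have := partsM d; rewrite /m /parts; case: (d) d0 => //= d' _; exact: sumn_cnt.
  rewrite isum_iota /= -sumrB addrAC -sumrB.
  have -> : \sum_(a < n.+1) isum [seq x.2 | x <- nth [::] nu a]
     = \sum_(a < n.+1) \sum_(x <- nth [::] nu a) x.2.
    by apply: eq_bigr => a _; rewrite isumE big_map.
  congr (_ - _); apply: eq_bigr => i _; by rewrite sumrB.
rewrite [RHS]addrAC; congr (_ - _).
rewrite exchange_big /= -big_split /=; apply: eq_bigr => i _.
have mz : m n.+2 i = 0 by rewrite /m /cnt /parts /= /lens /= nth_default // sz.
have tel := tri_telescope n.+1 (m^~ i); have tail := sum_tail (m^~ i) dn.
rewrite (eq_bigr (fun a : 'I_n.+2 => - tri (m a i - m a.+1 i - 1)
   - Posz (d <= a)%N * (m a i - m a.+1 i))) // [in RHS]sumrB sumrN tail.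
rewrite [in RHS]big_ord_recr /= mz !subr0.
by move: tel; rewrite /= -[cnt lam i]/(m 0%N i); slia.
Qed.

(** * Strong duality for the tau functions *)

Definition dualK (M : nat) (lam : seq nat) : int := \sum_(1 <= i < M.+1) tri (cnt lam i - 1).

Definition dual (n M d : nat) (lam : seq nat) (cfg : config) (phi : pot) : int :=
  base n M d lam phi + posq 0 cfg phi.

Lemma tau_val_le n M d lam nu phi : (0 < n)%N -> size nu = n -> (0 < d <= n.+1)%N ->
  all (fun x => x <= M)%N lam -> bounded M nu ->
  tau_val n lam nu d <= base n M d lam phi + linq 0 nu phi + dualK M lam.
Proof.
move=> n0 sz dn lamM nuM; rewrite (tau_valE n0 sz dn lamM nuM) (@base_linq n M) //.
rewrite lerD2r lerD2r; apply: ler_sum => a _; apply: ler_sum => i _; exact: tri_conj.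
Qed.

Lemma tau_val_eq n M d lam nu phi : (0 < n)%N -> size nu = n -> (0 < d <= n.+1)%N ->
  all (fun x => x <= M)%N lam -> bounded M nu ->
  (forall a i, (0 < i)%N -> dk phi a i = ych lam nu a i) ->
  tau_val n lam nu d = base n M d lam phi + linq 0 nu phi + dualK M lam.
Proof.
move=> n0 sz dn lamM nuM phiE; rewrite (tau_valE n0 sz dn lamM nuM) (@base_linq n M) //.
congr (_ - _ + _); apply: eq_bigr => a _; apply: eq_big_nat => i /andP[i0 _].
by rewrite phiE // tri_conj_eq.
Qed.

Lemma mem_subseqs_sub (T : eqType) (s t : seq T) : t \in subseqs s -> {subset t <= s}.
Proof.
elim: s t => [|y s IHs] t /=; first by rewrite mem_seq1 => /eqP ->.
rewrite mem_cat => /orP[/mapP[v vin ->]|tin] x; rewrite !inE.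
  by case/orP=> [->//|xv]; rewrite (IHs _ vin) // orbT.
by move=> xt; rewrite (IHs _ tin) // orbT.
Qed.

Lemma all_choices_sub (cfg nu : config) : nu \in all_choices cfg ->
  size nu = size cfg /\ forall a, {subset nth [::] nu a <= nth [::] cfg a}.
Proof.
elim: cfg nu => [|c cfg IH] nu /=; first by rewrite mem_seq1 => /eqP ->; split=> // a.
case/allpairsP => [[t u] [/= tin uin ->]]; have [sz sub] := IH _ uin.
by split; [rewrite /= sz|case=> [|a] //=; exact: mem_subseqs_sub].
Qed.

Lemma all_choices_bounded M (cfg nu : config) : nu \in all_choices cfg ->
  bounded M cfg -> bounded M nu.
Proof.
case/all_choices_sub=> _ sub cM a; apply/allP => _ /mapP[x xin ->].
by apply: (allP (cM a)); apply: map_f; apply: sub.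
Qed.

Lemma subseqs_self (T : eqType) (s : seq T) : s \in subseqs s.
Proof. by elim: s => //= x s IH; rewrite mem_cat map_f. Qed.

Lemma subseqs_nil (T : eqType) (s : seq T) : [::] \in subseqs s.
Proof. by elim: s => //= x s IH; rewrite mem_cat IH orbT. Qed.

Lemma all_choices_self (cfg : config) : cfg \in all_choices cfg.
Proof.
elim: cfg => //= c cfg IH; apply/allpairsP; exists (c, cfg); split=> //=.
exact: subseqs_self.
Qed.

Lemma all_choices_nil (cfg : config) : nseq (size cfg) [::] \in all_choices cfg.
Proof.
elim: cfg => //= c cfg IH; apply/allpairsP; exists ([::], nseq (size cfg) [::]).
by split=> //=; exact: subseqs_nil.
Qed.

Lemma tau_ge n cfg lam d nu : nu \in all_choices cfg -> tau_val n lam nu d <= tau n cfg lam d.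
Proof.
rewrite /tau; elim: (all_choices cfg) => //= v s IH; rewrite inE le_max.
by case/orP=> [/eqP ->|/IH ->]; rewrite ?lexx ?orbT.
Qed.

Lemma tau_attained n cfg lam d : size cfg = n ->
  exists2 nu, nu \in all_choices cfg & tau n cfg lam d = tau_val n lam nu d.
Proof.
move=> sz; rewrite /tau.
have : forall s, {subset s <= all_choices cfg} ->
   exists2 nu, nu \in all_choices cfg &
   foldr Num.max (tau_val n lam (nseq n [::]) d) [seq tau_val n lam nu d | nu <- s]
   = tau_val n lam nu d.
  elim=> [|v s IH] sub /=.
    by exists (nseq n [::]) => //; rewrite -sz all_choices_nil.
  have [x xs|nu nuin ->] := IH; first by apply: sub; rewrite inE xs orbT.
  have vin : v \in all_choices cfg by apply: sub; rewrite mem_head.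
  by case: leP => _; [exists nu|exists v].
by apply.
Qed.

Lemma tau_le_dual n M d lam cfg phi : (0 < n)%N -> size cfg = n -> (0 < d <= n.+1)%N ->
  all (fun x => x <= M)%N lam -> bounded M cfg ->
  tau n cfg lam d <= dual n M d lam cfg phi + dualK M lam.
Proof.
move=> n0 sz dn lamM cM; have [nu nuin ->] := tau_attained lam d sz.
have [szn _] := all_choices_sub nuin.
apply: le_trans (@tau_val_le n M d lam nu phi n0 _ dn lamM _) _.
- by rewrite szn.
- exact: all_choices_bounded nuin cM.
by rewrite lerD2r lerD2l linq_le_posq.
Qed.

Lemma dual_attained n M d lam cfg : (0 < n)%N -> size cfg = n -> (0 < d <= n.+1)%N ->
  all (fun x => x <= M)%N lam -> bounded M cfg ->
  exists phi, dual n M d lam cfg phi + dualK M lam <= tau n cfg lam d.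
Proof.
move=> n0 sz dn lamM cM.
have opt nu : nu \in all_choices cfg -> exists phi,
    tau_val n lam nu d = base n M d lam phi + linq 0 nu phi + dualK M lam.
  move=> nuin; have [szn _] := all_choices_sub nuin.
  (* Summing the flow over heights gives a potential with the flow as increments. It makes Fenchel's
     inequality an equality, hence minimizes the linear problem of [nu]. *)
  exists (fun a i => \sum_(1 <= j < i.+1) ych lam nu a j).
  apply: tau_val_eq => //; [by rewrite szn|exact: all_choices_bounded nuin cM|].
  move=> a [|i] // _; rewrite /dk /= big_nat_recr //=.
  by case: i => [|i] /=; [rewrite big_geq // add0r subr0|rewrite addrAC subrr add0r].
have [|nu nuin|nu nuin [phi hphi]] := @min_posq (base n M d lam) 0 cfg.
- exact: Lconv_base.
- have [phi hphi] := opt nu nuin; exists phi => u.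
  have [szn _] := all_choices_sub nuin; rewrite -(lerD2r (dualK M lam)) -hphi.
  apply: tau_val_le => //; [by rewrite szn|exact: all_choices_bounded nuin cM].
have [psi hpsi] := opt nu nuin.
exists phi; apply: le_trans (tau_ge n lam d nuin); rewrite hpsi lerD2r; exact: hphi.
Qed.

(** * Effect on the dual of shifting one column on an interval *)

Definition inI (p q i : nat) : int := Posz (p <= i <= q)%N.

Definition cI (p q : nat) (l : seq nat) : int := \sum_(x <- l) inI p q x.

Definition vert (M d : nat) (phi : pot) (a : nat) : int :=
  \sum_(1 <= i < M.+1) (tri (dk phi a i) - Posz (d <= a)%N * dk phi a i).

(** The potential drop across a row of colour [b]; a zero column before column 0 lets [lam] count as
    colour 0. *)
Definition th (phi : pot) (b i : nat) : int :=
  if b == 0 then - ev phi 0 i else ev phi b.-1 i - ev phi b i.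

Definition ent (lam : seq nat) (C : config) (b : nat) (phi : pot) : int :=
  if b == 0 then \sum_(x <- lam) th phi 0 x
  else \sum_(x <- nth [::] C b.-1) pos (th phi b x.1 - x.2).

(** The empty colour [n.+1] is included so that every column has a colour on each side. *)
Lemma dualE n M d lam C phi : size C = n ->
  dual n M d lam C phi = \sum_(a < n.+1) vert M d phi a + \sum_(b < n.+2) ent lam C b phi.
Proof.
move=> sz; rewrite /dual /base -addrA; congr (_ + _).
rewrite big_ord_recl /= {1}/ent /= sumrN; congr (_ + _).
rewrite big_ord_recr /= {2}/ent /= nth_default ?sz // big_nil addr0 posqE sz.
by apply: eq_bigr => b _; rewrite /ent /=; apply: eq_bigr => x _.
Qed.

Definition shiftp (a p q : nat) (dl : int) (phi : pot) : pot :=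
  fun b i => phi b i + Posz (b == a) * inI p q i * dl.

Lemma ev_shiftp a p q dl phi b i : (0 < p)%N ->
  ev (shiftp a p q dl phi) b i = ev phi b i + Posz (b == a) * inI p q i * dl.
Proof. by case: i => [|i] //; rewrite /inI; case: p => //= p _; rewrite mulr0 mul0r addr0. Qed.

Lemma sum_indicator (A : int) N p : (0 < p)%N ->
  \sum_(1 <= i < N.+1) Posz (i == p) * A = Posz (p <= N)%N * A.
Proof.
move=> p0; elim: N => [|N IH]; first by rewrite big_geq // leqn0 -(negbK (p == _)) -lt0n p0 mul0r.
rewrite big_nat_recr //= IH -mulrDl; congr (_ * _); lia.
Qed.

(** Only the increments at [p] and [q.+1] change. Their linear terms cancel, except when [q = M] and
    [q.+1] is out of range. *)
Lemma vert_shiftp M d a p q dl phi : (0 < p <= q)%N -> (q <= M)%N ->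
  vert M d (shiftp a p q dl phi) a = vert M d phi a
   + (tri (dk phi a p + dl) - tri (dk phi a p))
   + (if (q < M)%N then tri (dk phi a q.+1 - dl) - tri (dk phi a q.+1)
      else - (Posz (d <= a)%N * dl)).
Proof.
case/andP=> p0 pq qM.
pose e := Posz (d <= a)%N.
pose A := tri (dk phi a p + dl) - tri (dk phi a p) - e * dl.
pose B := tri (dk phi a q.+1 - dl) - tri (dk phi a q.+1) + e * dl.
have E : vert M d (shiftp a p q dl phi) a - vert M d phi a =
    \sum_(1 <= i < M.+1) (Posz (i == p) * A + Posz (i == q.+1) * B).
  rewrite /vert -sumrB; apply: eq_big_nat => i /andP[i0 _].
  have -> : dk (shiftp a p q dl phi) a i =
     dk phi a i + (inI p q i - inI p q i.-1) * dl.
    by rewrite /dk !ev_shiftp // eqxx !mul1r; ring.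
  rewrite -/e /A /B /inI; have [->|ip] := eqVneq i p.
    have -> : (p == q.+1) = false by lia.
    have -> : (p <= p <= q)%N = true by lia.
    have -> : (p <= p.-1 <= q)%N = false by lia.
    by rewrite subr0 !mul1r mul0r; ring.
  have [->|iq] := eqVneq i q.+1.
    have -> : (p <= q.+1 <= q)%N = false by lia.
    have -> : (p <= q.+1.-1 <= q)%N = true by lia.
    by rewrite sub0r !mul1r mul0r mulN1r; ring.
  have -> : (p <= i.-1 <= q)%N = (p <= i <= q)%N by lia.
  by rewrite subrr !mul0r addr0; ring.
rewrite big_split /= !sum_indicator // in E.
rewrite -[LHS](subrK (vert M d phi a)) E (leq_trans pq qM) /A /B.
by case: ifP => /= h; ring.
Qed.

Lemma vert_shiftp_ne M d a b p q dl phi : (0 < p)%N -> b != a ->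
  vert M d (shiftp a p q dl phi) b = vert M d phi b.
Proof.
move=> p0 ba; apply: eq_bigr => i _.
by rewrite /dk !ev_shiftp // (negbTE ba) !mul0r !addr0.
Qed.

Lemma th_shiftp a p q dl phi b i : (0 < p)%N ->
  th (shiftp a p q dl phi) b i = th phi b i
    + (Posz (b == a.+1) - Posz (b == a)) * inI p q i * dl.
Proof.
move=> p0; rewrite /th; case: b => [|b] /=; rewrite !ev_shiftp //=.
  by case: a => [|a] /=; rewrite ?eqxx; ring.
by rewrite eqSS; ring.
Qed.

Lemma ent_eq lam C b phi psi : (forall i, th psi b i = th phi b i) ->
  ent lam C b psi = ent lam C b phi.
Proof.
by rewrite /ent; case: b => [|b] E /=; apply: eq_bigr => x _; rewrite E.
Qed.

(** The positive part is nondecreasing and 1-Lipschitz. *)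
Lemma ent_le lam C b phi psi p q : (forall i, th psi b i <= th phi b i + inI p q i) ->
  ent lam C b psi <= ent lam C b phi + cI p q (parts lam C b).
Proof.
rewrite /ent /cI /parts; case: b => [|b] E /=.
  by rewrite -big_split; apply: ler_sum => x _; apply: E.
rewrite big_map -big_split; apply: ler_sum => x _ /=; move: (E x.1).
by rewrite /pos /inI; case: (_ <= _ <= _)%N; lia.
Qed.

Lemma sum_two (F : nat -> int) N a : (a.+1 < N)%N ->
  (forall b, b != a -> b != a.+1 -> F b = 0) -> \sum_(b < N) F b = F a + F a.+1.
Proof.
move=> aN F0; rewrite (bigD1 (Ordinal (ltnW aN))) //=; congr (_ + _).
rewrite (bigD1 (Ordinal aN)) /=; last by rewrite -val_eqE /= neq_ltn ltnSn orbT.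
rewrite big1 ?addr0 // => i; rewrite -!val_eqE /= => /andP[h1 h2]; exact: F0.
Qed.

Lemma dual_shiftp n M d lam C a p q dl phi : size C = n -> (0 < p)%N -> (a <= n)%N ->
  dual n M d lam C (shiftp a p q dl phi) - dual n M d lam C phi =
  (vert M d (shiftp a p q dl phi) a - vert M d phi a)
  + (ent lam C a (shiftp a p q dl phi) - ent lam C a phi)
  + (ent lam C a.+1 (shiftp a p q dl phi) - ent lam C a.+1 phi).
Proof.
move=> sz p0 an; rewrite !dualE // opprD addrACA -[RHS]addrA; congr (_ + _).
  rewrite -sumrB (bigD1 (inord a)) //= inordK // big1 ?addr0 // => b.
  rewrite -val_eqE /= inordK // => ba; rewrite vert_shiftp_ne //; exact: subrr.
rewrite -sumrB; apply: (@sum_two (fun b => ent lam C b (shiftp a p q dl phi) - ent lam C b phi)) => // b h1 h2.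
rewrite (@ent_eq _ _ _ phi) ?subrr // => i.
by rewrite th_shiftp // (negbTE h1) (negbTE h2) subrr !mul0r addr0.
Qed.

(** * Shortening a single row *)

Lemma down_interval (P : pred nat) L : ~~ P 0%N -> P L ->
  exists p, [/\ (0 < p <= L)%N, ~~ P p.-1 & forall i, (p <= i <= L)%N -> P i].
Proof.
move=> P0; elim: L => [|L IH] PL; first by rewrite PL in P0.
have [/IH [p [hp Pp hi]]|nP] := boolP (P L).
  exists p; split=> //; first lia.
  move=> i /andP[pi]; rewrite leq_eqVlt => /orP[/eqP -> //|iL]; apply: hi; lia.
by exists L.+1; split=> // [|i hi]; [lia|have -> : i = L.+1 by lia].
Qed.

Lemma up_interval (P : pred nat) L M : (L <= M)%N -> P L ->
  exists q, [/\ (L <= q <= M)%N, (q < M)%N -> ~~ P q.+1 & forall i, (L <= i <= q)%N -> P i].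
Proof.
move=> LM PL; elim: M LM => [|M IH] LM.
  by exists L; split; [lia|lia|move=> i hi; have -> : i = L by lia].
move: LM; rewrite leq_eqVlt => /orP[/eqP LE|].
  by exists L; split; [lia|lia|move=> i hi; have -> : i = L by lia].
rewrite ltnS => LM; have [q [hq Pq hi]] := IH LM.
have [qM|qM] := ltnP q M; first by exists q; split=> //; [lia|move=> _; exact: Pq].
have {qM} qM : q = M by lia.
have [PM|nP] := boolP (P M.+1).
  exists M.+1; split=> [||i]; [lia|lia|].
  case/andP=> Li; rewrite leq_eqVlt => /orP[/eqP -> //|iM]; apply: hi; lia.
by exists M; split=> [|//|i h]; [lia|apply: hi; lia].
Qed.

Lemma tri_succ k : tri (k + 1) = tri k + k + 1.
Proof. have := triE (k + 1); have := triE k; lia. Qed.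

Lemma tri_pred k : tri (k - 1) = tri k - k.
Proof. have := triE (k - 1); have := triE k; lia. Qed.

(* The chosen row [(La, v La)] of colour [a] is replaced by the shortened one;
   [v] is the vacancy number of colour [a], [Lp] the row chosen in colour
   [a - 1], and [Rm p q] the number of rows of colour [a - 1] with length in
   [[p, q]] before that row was shortened. *)
Section RowMove.

Variables (n M d : nat) (lam : seq nat) (C C' : config) (a Lp La : nat).
Variables (v : nat -> int) (Rm : nat -> nat -> int) (rest : seq (nat * int)).

Let t : int := Posz (Lp < La)%N.

Hypothesis an : (0 < a <= n)%N.
Hypothesis szC : size C = n.
Hypothesis szC' : size C' = n.
Hypothesis permC : perm_eq (nth [::] C a.-1) ((La, v La) :: rest).
Hypothesis permC' : perm_eq (nth [::] C' a.-1) ((La.-1, v La.-1 - t) :: rest).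
Hypothesis sameC : forall b, b != a.-1 -> nth [::] C' b = nth [::] C b.
Hypothesis hL : (0 < Lp <= La)%N.
Hypothesis LaM : (La <= M)%N.
Hypothesis v0 : v 0%N = 0.
Hypothesis vtop : v M.+1 = v M.
Hypothesis vslope : forall p q, (0 < p <= q)%N ->
  (v p - v p.-1) - (v q.+1 - v q) =
  Rm p q - 2 * (cI p q [seq x.1 | x <- rest] + inI p q La) + cI p q (parts lam C a.+1).
Hypothesis Rmle : forall p q, (0 < p <= q)%N ->
  cI p q (parts lam C a.-1) <= Rm p q - inI p q Lp + inI p q Lp.-1.
Hypothesis restv : forall x, x \in rest -> x.2 <= v x.1 - Posz (Lp <= x.1 < La)%N.

(** The part of the dual common to [C] and [C'], without the moving row. *)
Let Rr (phi : pot) : int := dual n M d lam C phi - pos (th phi a La - v La).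

Lemma ent_rest (D : config) x0 phi : perm_eq (nth [::] D a.-1) (x0 :: rest) ->
  ent lam D a phi = pos (th phi a x0.1 - x0.2) + \sum_(x <- rest) pos (th phi a x.1 - x.2).
Proof.
move=> pD; rewrite /ent; have -> : (a == 0) = false by lia.
by rewrite (perm_big _ pD) /= big_cons.
Qed.

Lemma dual_move phi :
  dual n M d lam C' phi = Rr phi + pos (th phi a La.-1 - (v La.-1 - t)).
Proof.
rewrite /Rr; apply/eqP; rewrite addrAC eq_sym subr_eq; apply/eqP.
have an2 : (a < n.+2)%N by lia.
rewrite !dualE // -!addrA; congr (_ + _).
rewrite (bigD1 (Ordinal an2)) //= [in RHS](bigD1 (Ordinal an2)) //=.
rewrite (ent_rest _ permC) (ent_rest _ permC') /=.
have -> : \sum_(i < n.+2 | i != Ordinal an2) ent lam C' i phi =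
          \sum_(i < n.+2 | i != Ordinal an2) ent lam C i phi.
  apply: eq_bigr => i; rewrite -val_eqE /= => ia.
  rewrite /ent; case: (val i) ia => [|j] //= ja; rewrite sameC //; lia.
slia.
Qed.

(** By [restv], every remaining row with length in the interval has excess at least 1, so its
    positive part drops by exactly 1. *)
Lemma rest_drop phi psi p q :
  (forall i, (p <= i <= q)%N -> v i - th phi a i < Posz (Lp <= i < La)%N) ->
  (forall i, th psi a i = th phi a i - inI p q i) ->
  \sum_(x <- rest) pos (th psi a x.1 - x.2) =
  \sum_(x <- rest) pos (th phi a x.1 - x.2) - cI p q [seq x.1 | x <- rest].
Proof.
move=> neg E; rewrite /cI big_map -sumrB big_seq [RHS]big_seq; apply: eq_bigr => -[x s] xr /=.
have := restv xr; rewrite E /inI /pos /=.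
case h : (p <= x <= q)%N; last by lia.
by move: (neg _ h); lia.
Qed.

Lemma Rr_shiftp phi c p q dl : (c == a) || (c == a.-1) -> (0 < p)%N ->
  (forall i, (p <= i <= q)%N -> v i - th phi a i < Posz (Lp <= i < La)%N) ->
  (forall i, th (shiftp c p q dl phi) a i = th phi a i - inI p q i) ->
  let b := if c == a then a.+1 else a.-1 in
  Rr (shiftp c p q dl phi) - Rr phi =
  (vert M d (shiftp c p q dl phi) c - vert M d phi c)
  + (ent lam C b (shiftp c p q dl phi) - ent lam C b phi) - cI p q [seq x.1 | x <- rest].
Proof.
move=> hc p0 neg E b; have := rest_drop neg E.
have cn : (c <= n)%N by move: hc an; lia.
have := @dual_shiftp n M d lam C c p q dl phi szC p0 cn.
have e1 := ent_rest phi permC; have e2 := ent_rest (shiftp c p q dl phi) permC.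
rewrite /Rr /b; case: eqVneq hc => [ca _|ca /= /eqP cE].
  by move: e1 e2; rewrite ca /=; slia.
have -> : c.+1 = a by lia.
by move: e1 e2; rewrite cE /=; slia.
Qed.

(* The two ways of raising [w] by one on [[p, q]], lowering column [a - 1] or
   raising column [a], together cost at most 1, hence one of them is free. *)
Lemma move_interval phi p q : (0 < p <= q)%N -> (q <= M)%N ->
  let w i := v i - th phi a i in
  (forall i, (p <= i <= q)%N -> w i < Posz (Lp <= i < La)%N) ->
  (w p - w p.-1) + (if (q < M)%N then 2 - (w q.+1 - w q) else 1)
    + inI p q Lp.-1 - inI p q Lp + 2 * inI p q La <= 1 ->
  exists psi, Rr psi <= Rr phi /\ forall i, th psi a i = th phi a i - inI p q i.
Proof.
move=> hpq qM w neg bound; have p0 : (0 < p)%N by lia.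
pose psi1 := shiftp a.-1 p q (-1) phi; pose psi2 := shiftp a p q 1 phi.
have th1 i : th psi1 a i = th phi a i - inI p q i.
  rewrite th_shiftp // prednK; last by lia.
  have -> : (a == a.-1) = false by lia.
  by rewrite eqxx /=; lia.
have th2 i : th psi2 a i = th phi a i - inI p q i.
  have -> : th psi2 a i = th phi a i + (Posz (a == a.+1) - Posz (a == a)) * inI p q i * 1.
    exact: th_shiftp.
  by rewrite eqxx; have -> : (a == a.+1) = false; lia.
have R1 := @Rr_shiftp phi a.-1 p q (-1) _ p0 neg th1.
have R2 := @Rr_shiftp phi a p q 1 _ p0 neg th2.
have := R1 _; rewrite eqxx orbT => /(_ isT); have -> : (a.-1 == a) = false by lia.
move=> {}R1; have := R2 _; rewrite eqxx => /(_ isT) {}R2.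
have e1 : ent lam C a.-1 psi1 <= ent lam C a.-1 phi + cI p q (parts lam C a.-1).
  apply: ent_le => i; rewrite th_shiftp // eqxx.
  have -> : (a.-1 == a.-1.+1) = false by lia.
  by rewrite /inI /=; lia.
have e2 : ent lam C a.+1 psi2 <= ent lam C a.+1 phi + cI p q (parts lam C a.+1).
  apply: ent_le => i; rewrite th_shiftp // eqxx.
  have -> : (a.+1 == a) = false by lia.
  by rewrite /inI /=; lia.
have V1 := @vert_shiftp M d a.-1 p q (-1) phi hpq qM.
have V2 := @vert_shiftp M d a p q 1 phi hpq qM.
have sl := vslope hpq; have rm := Rmle hpq.
have thE i : th phi a i = ev phi a.-1 i - ev phi a i.
  by rewrite /th; have -> : (a == 0) = false by lia.
(* The costs at [p] and [q.+1] produce the slopes of [th], while [vslope] and [Rmle] turn row counts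
   into slopes of [v]; the total is at most the left side of [bound]. *)
have sum1 : (Rr psi1 - Rr phi) + (Rr psi2 - Rr phi) <= 1.
  rewrite R1 R2 V1 V2 -/psi1 -/psi2.
  rewrite opprK !tri_succ !tri_pred.
  move: bound e1 e2 sl rm; rewrite /w !thE /dk /=.
  case: ltnP => hq.
    slia.
  (* At the top, the uncancelled linear terms of the two shifts add up to the indicator of
     [d <= a.-1] minus that of [d <= a]. *)
  have -> : q = M by lia.
  rewrite vtop; have : Posz (d <= a.-1)%N <= Posz (d <= a)%N by lia.
  slia.
have [h|h] := lerP (Rr psi1) (Rr phi); first by exists psi1.
by exists psi2; split=> //; lia.
Qed.

(** While the short row costs more than the long one, [th] is lowered by 1 on a maximal interval
    ending at [La.-1]. The long row is untouched and the cost of the short row, on which the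
    induction runs, falls. *)
Lemma dual_shorten_row phi : exists psi, dual n M d lam C' psi <= dual n M d lam C phi.
Proof.
pose w (phi : pot) i : int := v i - th phi a i.
have [N] := ubnP `|pos (t - w phi La.-1)|%N; elim: N phi => // N IH phi ltN.
pose P := [pred i : nat | w phi i < Posz (Lp <= i < La)%N].
have dC psi : dual n M d lam C psi = Rr psi + pos (- w psi La).
  by rewrite /Rr /w opprB subrK.
have dC' psi : dual n M d lam C' psi = Rr psi + pos (t - w psi La.-1).
  by rewrite dual_move /w; congr (_ + pos _); ring.
have [done_|] := lerP (pos (t - w phi La.-1)) (pos (- w phi La)).
  by exists phi; rewrite dC dC' lerD2l.
move=> bad.
have PL : P La.-1 by move: bad; rewrite /= /t /pos; lia.
have th0 psi : th psi a 0 = 0 by rewrite /th; case: (a) an.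
(* Both [v] and [th] vanish at height 0 and [Lp > 0], so the interval stops above the ground. *)
have P0 : ~~ P 0%N by rewrite /= /w v0 th0; lia.
have [p [hp nPp hP]] := down_interval P0 PL.
have [||||psi [Rpsi thpsi]] := @move_interval phi p La.-1.
- lia.
- lia.
- by move=> i /hP.
- have := hP p; have := hP La.-1; move: nPp bad; rewrite /= -!/(w phi _) /t /pos /inI.
  have -> : (La.-1 < M)%N by lia.
  rewrite (@prednK La); last by lia.
  move=> h1 h2 /(_ ltac:(lia)) h3 /(_ ltac:(lia)) h4.
  lia.
have wpsi i : w psi i = w phi i + inI p La.-1 i by rewrite /w thpsi; ring.
have [|psi' hpsi'] := IH psi.
  rewrite wpsi; have -> : inI p La.-1 La.-1 = 1 by rewrite /inI; have -> : (p <= La.-1 <= La.-1)%N by lia.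
  by move: PL ltN; rewrite /= /t /pos; lia.
exists psi'; apply: le_trans hpsi' _; rewrite !dC wpsi.
have -> : inI p La.-1 La = 0 by rewrite /inI; have -> : (p <= La <= La.-1)%N = false by lia.
by rewrite addr0 lerD2r.
Qed.

(** Symmetric argument: the interval starts at [La] and goes up, missing the height [La.-1] of the
    short row. *)
Lemma dual_lengthen_row phi : exists psi, dual n M d lam C psi <= dual n M d lam C' phi.
Proof.
pose w (phi : pot) i : int := v i - th phi a i.
have [N] := ubnP `|pos (- w phi La)|%N; elim: N phi => // N IH phi ltN.
pose P := [pred i : nat | w phi i < 0].
have dC psi : dual n M d lam C psi = Rr psi + pos (- w psi La).
  by rewrite /Rr /w opprB subrK.
have dC' psi : dual n M d lam C' psi = Rr psi + pos (t - w psi La.-1).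
  by rewrite dual_move /w; congr (_ + pos _); ring.
have [done_|] := lerP (pos (- w phi La)) (pos (t - w phi La.-1)).
  by exists phi; rewrite dC dC' lerD2l.
move=> bad.
have PL : P La by move: bad; rewrite /= /t /pos; lia.
have [q [hq nPq hP]] := up_interval LaM PL.
have [||||psi [Rpsi thpsi]] := @move_interval phi La q.
- lia.
- lia.
- by move=> i /hP /=; rewrite /w; lia.
- have := hP q; move: nPq bad PL; rewrite /= -!/(w phi _) /t /pos /inI.
  case: ltnP => hM h1 bad PL /(_ ltac:(lia)) h3; last by lia.
  by have := h1 isT; lia.
have wpsi i : w psi i = w phi i + inI La q i by rewrite /w thpsi; ring.
have [|psi' hpsi'] := IH psi.
  rewrite wpsi; have -> : inI La q La = 1 by rewrite /inI; have -> : (La <= La <= q)%N by lia.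
  by move: PL ltN; rewrite /= /pos; lia.
exists psi'; apply: le_trans hpsi' _; rewrite !dC' wpsi.
have -> : inI La q La.-1 = 0 by rewrite /inI; have -> : (La <= La.-1 <= q)%N = false by lia.
by rewrite addr0 lerD2r.
Qed.

End RowMove.

(** * Row selection and vacancy numbers *)

Lemma foldr_minn c cs : foldr minn c cs \in c :: cs /\
  forall x, x \in c :: cs -> (foldr minn c cs <= x)%N.
Proof.
elim: cs => [|y cs [IH1 IH2]] /=; first by rewrite mem_head; split=> // x; rewrite inE => /eqP ->.
split.
  rewrite /minn; case: ifP => _; first by rewrite !inE eqxx orbT.
  by move: IH1; rewrite !inE => /orP[->|->]; rewrite ?orbT.
move=> x; rewrite !inE geq_min => /or3P[/eqP ->|/eqP ->|h]; rewrite ?leqnn //.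
  by rewrite IH2 ?mem_head ?orbT.
by rewrite IH2 ?orbT // inE h orbT.
Qed.

(** Entry [j] of [lp :: ch] is the length chosen just before entry [j] of [ch]. *)
Lemma choose_rows_spec mu0 cfg k i lp : (0 < i)%N ->
  let ch := choose_rows mu0 cfg i k lp in
  [/\ (size ch <= k)%N,
     forall j, (j < size ch)%N ->
       [/\ (nth 0 (lp :: ch) j <= nth 0 ch j)%N,
          (nth 0%N ch j, vac mu0 cfg (i + j) (nth 0%N ch j)) \in nth [::] cfg (i + j).-1 &
          forall x, x \in nth [::] cfg (i + j).-1 ->
             (nth 0 (lp :: ch) j <= x.1 < nth 0 ch j)%N -> x.2 != vac mu0 cfg (i + j) x.1] &
     (size ch < k)%N -> forall x, x \in nth [::] cfg (i + size ch).-1 ->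
       (nth 0 (lp :: ch) (size ch) <= x.1)%N -> x.2 != vac mu0 cfg (i + size ch) x.1].
Proof.
elim: k i lp => [|k IH] i lp i0 //=.
set cands := [seq x.1 | x <- _ & _].
have candP z : z \in cands ->
    (lp <= z)%N /\ (z, vac mu0 cfg i z) \in nth [::] cfg i.-1.
  case/mapP=> x; rewrite mem_filter => /andP[/andP[h1 /eqP h2] xin] ->.
  by split=> //; rewrite -h2 -surjective_pairing.
have candI x : x \in nth [::] cfg i.-1 -> (lp <= x.1)%N -> x.2 = vac mu0 cfg i x.1 ->
    x.1 \in cands.
  by move=> xin h1 h2; apply: map_f; rewrite mem_filter h1 h2 eqxx.
case E : cands => [|c cs].
  split=> //= _ x; rewrite addn0 => xin h; apply/eqP => h2.
  by move: (candI x xin h h2); rewrite E.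
have [] := foldr_minn c cs; rewrite -E; set l := foldr _ _ _ => lin lmin.
have [le_lp lcfg] := candP l lin.
have [h1 h2 h3] := IH i.+1 l isT; split=> //=.
- move=> [|j] /=; rewrite ?ltnS ?addn0 ?addnS => hj.
    split=> // x xin /andP[h h']; apply/eqP => hx.
    by move: (lmin _ (candI x xin h hx)); rewrite leqNgt h'.
  by have := h2 j hj; rewrite addSn.
- by rewrite ltnS addnS => hk; have := h3 hk; rewrite addSn.
Qed.

(** Its slopes are the counts [cnt], and differences of slopes count the rows in an interval. *)
Definition mn (l : seq nat) (j : nat) : int := \sum_(x <- l) Posz (minn j x).

Lemma EfE mu0 cfg b j : Ef mu0 cfg b j = mn (parts mu0 cfg b) j.
Proof.
have sE l : Posz (sumn [seq minn j m | m <- l]) = mn l j.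
  by rewrite /mn; elim: l => [|x l IH]; rewrite ?big_nil ?big_cons //= PoszD IH.
by rewrite /Ef /parts; case: (b == 0).
Qed.

Lemma vacE mu0 cfg a j : vac mu0 cfg a j =
  mn (parts mu0 cfg a.-1) j - 2 * mn (parts mu0 cfg a) j + mn (parts mu0 cfg a.+1) j.
Proof. by rewrite /vac !EfE. Qed.

Lemma mn0 l : mn l 0 = 0.
Proof. by rewrite /mn big1 // => x _; rewrite min0n. Qed.

Lemma mn_slope l p : (0 < p)%N -> mn l p - mn l p.-1 = cnt l p.
Proof.
move=> p0; rewrite /mn -sumrB; elim: l => [|x l IH]; first by rewrite big_nil.
by rewrite big_cons cnt_cons IH; lia.
Qed.

Lemma cntB_cI l p q : (0 < p <= q)%N -> cnt l p - cnt l q.+1 = cI p q l.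
Proof.
move=> pq; rewrite /cI; elim: l => [|x l IH]; first by rewrite big_nil.
by rewrite big_cons -IH !cnt_cons /inI; lia.
Qed.

Lemma mn_slope2 l p q : (0 < p <= q)%N ->
  (mn l p - mn l p.-1) - (mn l q.+1 - mn l q) = cI p q l.
Proof.
move=> pq; rewrite mn_slope; last by lia.
by have := @mn_slope l q.+1 isT => /= ->; apply: cntB_cI.
Qed.

Lemma vac_slope mu0 cfg a p q : (0 < p <= q)%N ->
  (vac mu0 cfg a p - vac mu0 cfg a p.-1) - (vac mu0 cfg a q.+1 - vac mu0 cfg a q) =
  cI p q (parts mu0 cfg a.-1) - 2 * cI p q (parts mu0 cfg a) + cI p q (parts mu0 cfg a.+1).
Proof.
move=> pq; rewrite !vacE -!(mn_slope2 _ pq); lia.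
Qed.

Lemma mn_top l M : all (fun x => x <= M)%N l -> mn l M.+1 = mn l M.
Proof.
move/allP => h; rewrite /mn big_seq [RHS]big_seq; apply: eq_bigr => x /h; lia.
Qed.

Lemma exists_bound mu0 (cfg : config) : exists M, all (fun x => x <= M)%N mu0 /\ bounded M cfg.
Proof.
have sq (l : seq nat) : all (fun x => x <= sumn l)%N l.
  elim: l => //= x l IH; rewrite leq_addr; apply: sub_all IH => y /=; lia.
exists (sumn mu0 + sumn [seq sumn [seq x.1 | x <- c] | c <- cfg])%N; split.
  by apply: sub_all (sq mu0) => x /=; lia.
move=> a; have [h|h] := ltnP a (size cfg); last by rewrite nth_default.
apply/allP => y /(allP (sq _)) => hy; apply: leq_trans hy _.
have cin := map_f (fun c : seq (nat * int) => sumn [seq x.1 | x <- c]) (mem_nth [::] h).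
by have := allP (sq _) _ cin => /=; lia.
Qed.

Lemma parts_bound M mu0 cfg b : all (fun x => x <= M)%N mu0 -> bounded M cfg ->
  all (fun x => x <= M)%N (parts mu0 cfg b).
Proof. by move=> h1 h2; rewrite /parts; case: (b == 0); rewrite ?h1 //; apply: h2. Qed.

Lemma vac_top mu0 cfg a M : all (fun x => x <= M)%N mu0 -> bounded M cfg ->
  vac mu0 cfg a M.+1 = vac mu0 cfg a M.
Proof. by move=> h1 h2; rewrite !vacE !mn_top //; apply: parts_bound. Qed.

Lemma vac0 mu0 cfg a : vac mu0 cfg a 0 = 0.
Proof. by rewrite vacE !mn0. Qed.

Lemma cI_ge0 p q l : 0 <= cI p q l.
Proof. by rewrite /cI sumr_ge0. Qed.

Lemma cI_mem p q l x : x \in l -> inI p q x <= cI p q l.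
Proof.
move=> xl; rewrite /cI (perm_big _ (perm_to_rem xl)) big_cons lerDl; exact: cI_ge0.
Qed.

Lemma cI_eq0 j l : j \notin l -> cI j j l = 0.
Proof.
move=> jl; rewrite /cI big1_seq // => x /andP[_ xl]; rewrite /inI.
by case h : (j <= x <= j)%N => //; have xj : x = j by [lia]; rewrite xj in xl; rewrite xl in jl.
Qed.

(** Keeping the count of the preceding colour gives strict concavity at a length occurring there. *)
Lemma vac_concave mu0 cfg a j : (0 < j)%N -> j \notin parts mu0 cfg a ->
  cI j j (parts mu0 cfg a.-1) <=
  (vac mu0 cfg a j - vac mu0 cfg a j.-1) - (vac mu0 cfg a j.+1 - vac mu0 cfg a j).
Proof.
move=> j0 jl; rewrite vac_slope; last by lia.
by rewrite (cI_eq0 jl); have := cI_ge0 j j (parts mu0 cfg a.+1); lia.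
Qed.

Lemma mem_parts mu0 cfg a x : (0 < a)%N -> x \in parts mu0 cfg a ->
  exists2 r, r \in nth [::] cfg a.-1 & r.1 = x.
Proof. by case: a => // a _ /mapP[r rin ->]; exists r. Qed.

(* A negative vacancy number would keep decreasing above the first negative one,
   since rows of colour [a] are the only obstruction to concavity. *)
Lemma vac_ge0 n mu0 cfg a j : is_RC n mu0 cfg -> (0 < a <= n)%N -> 0 <= vac mu0 cfg a j.
Proof.
case=> sz mu0P rows han; have a0 : (0 < a)%N by lia.
have [M [h1 h2]] := exists_bound mu0 cfg.
rewrite leNgt; apply/negP => neg.
have exP : exists i, vac mu0 cfg a i < 0 by exists j.
have [i0 ineg imin] := ex_minnP exP.
have nl i : vac mu0 cfg a i < 0 -> i \notin parts mu0 cfg a.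
  move=> h; apply/negP => /(mem_parts a0)[r rin ri].
  by have := rows a han r rin; rewrite ri => -[_]; lia.
have i0_gt0 : (0 < i0)%N by case: (i0) ineg => //; rewrite vac0.
have step k : vac mu0 cfg a (i0 + k)%N < 0 /\
   vac mu0 cfg a (i0 + k)%N < vac mu0 cfg a (i0 + k).-1.
  elim: k => [|k [IH1 IH2]].
    rewrite addn0; split=> //; case: (ltP (vac mu0 cfg a i0.-1) 0) => h; last by lia.
    by have := imin _ h; lia.
  have ik : (0 < i0 + k)%N by lia.
  have := vac_concave ik (nl _ IH1); rewrite addnS /=.
  by have := cI_ge0 (i0 + k) (i0 + k) (parts mu0 cfg a.-1); lia.
(* The strict decrease would continue past [M], where vacancy numbers are constant. *)
have [_] := step M.+1; rewrite addnS /=.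
have M1 i : (M <= i)%N -> vac mu0 cfg a i.+1 = vac mu0 cfg a i.
  move=> Mi; apply: vac_top => //.
    by apply: sub_all h1 => x /=; lia.
  by move=> b; apply: sub_all (h2 b) => x /=; lia.
by rewrite M1 ?ltxx //; lia.
Qed.

(** * One step of the KKR map yields a rigged configuration *)

Section Step.

Variables (n : nat) (pre : seq nat) (l0 : nat) (cfg : config).
Let mu0 := rcons pre l0.
Hypothesis n0 : (0 < n)%N.
Hypothesis RC : is_RC n mu0 cfg.

Let ch := choose_rows mu0 cfg 1 n l0.
Let J := size ch.
(** [L 0] is the length of the processed row and [L i], for [1 <= i <= J], the length chosen in
    colour [i]. Entry [i] of a configuration holds colour [i.+1], hence the shift in [cut]. *)
Let L i := nth 0%N (l0 :: ch) i.
Let cut i := rem (L i.+1, vac mu0 cfg i.+1 (L i.+1)) (nth [::] cfg i).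
Let mu0' := if l0.-1 == 0 then pre else rcons pre l0.-1.
Let tmp : config := mkseq (fun i => if (i < J)%N then rcons (cut i) ((L i.+1).-1, 0%:Z)
                           else nth [::] cfg i) (size cfg).
Let cfg' : config := mkseq (fun i => if (i < J)%N then
     if (L i.+1).-1 == 0 then cut i
     else rcons (cut i) ((L i.+1).-1, vac mu0' tmp i.+1 (L i.+1).-1)
   else nth [::] cfg i) (size cfg).

Lemma kkr_stepE : kkr_step n (mu0, cfg) = (J.+1, (mu0', cfg')).
Proof.
rewrite /kkr_step; have -> : last 0%N mu0 = l0 by rewrite last_rcons.
by have -> : take (size mu0).-1 mu0 = pre by rewrite size_rcons /mu0 -cats1 take_size_cat.
Qed.

Lemma szcfg : size cfg = n. Proof. by case: RC. Qed.

Lemma l0_gt0 : (0 < l0)%N.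
Proof. by case: RC => _; rewrite all_rcons => /andP[]. Qed.

Lemma J_le : (J <= n)%N.
Proof. by have [] := @choose_rows_spec mu0 cfg n 1 l0 isT. Qed.

Lemma L_spec i : (i < J)%N ->
  [/\ (L i <= L i.+1)%N, (L i.+1, vac mu0 cfg i.+1 (L i.+1)) \in nth [::] cfg i &
     forall x, x \in nth [::] cfg i -> (L i <= x.1 < L i.+1)%N -> x.2 != vac mu0 cfg i.+1 x.1].
Proof.
by have [_ h _] := @choose_rows_spec mu0 cfg n 1 l0 isT => /h; rewrite add1n.
Qed.

Lemma L_last x : (J < n)%N -> x \in nth [::] cfg J -> (L J <= x.1)%N ->
  x.2 != vac mu0 cfg J.+1 x.1.
Proof.
have [_ _ h] := @choose_rows_spec mu0 cfg n 1 l0 isT.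
by move=> /h; rewrite add1n; apply.
Qed.

Lemma L_gt0 i : (i <= J)%N -> (0 < L i)%N.
Proof.
elim: i => [|i IH] hi; first exact: l0_gt0.
by have [h _ _] := L_spec hi; apply: leq_trans h; apply: IH; apply: ltnW.
Qed.

Lemma L_mem i : (i <= J)%N -> L i \in parts mu0 cfg i.
Proof.
case: i => [|i] hi; first by rewrite /parts /mu0 mem_rcons mem_head.
by have [_ h _] := L_spec hi; rewrite /parts /=; apply/mapP; exists (L i.+1, vac mu0 cfg i.+1 (L i.+1)).
Qed.

Lemma perm_cut i : (i < J)%N ->
  perm_eq (nth [::] cfg i) ((L i.+1, vac mu0 cfg i.+1 (L i.+1)) :: cut i).
Proof. by move=> /L_spec[_ h _]; apply: perm_to_rem. Qed.

(** Shortening a row of length [L b] lowers its minimum with [j] exactly when [L b <= j]; colours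
    beyond [J] do not change. *)
Definition gch b j : int := Posz ((b <= J)%N && (L b <= j)%N).

Lemma mn_cons x l j : mn (x :: l) j = Posz (minn j x) + mn l j.
Proof. by rewrite /mn big_cons. Qed.

Lemma mn_perm l1 l2 j : perm_eq l1 l2 -> mn l1 j = mn l2 j.
Proof. by move=> h; rewrite /mn (perm_big _ h). Qed.

Lemma mn_rcons x l j : mn (rcons l x) j = Posz (minn j x) + mn l j.
Proof. by rewrite (mn_perm _ (_ : perm_eq _ (x :: l))) ?perm_rcons // mn_cons. Qed.

Lemma mn_mu0' j : mn mu0' j = mn mu0 j - gch 0 j.
Proof.
rewrite /mu0' /mu0 /gch /L /=; have := l0_gt0.
by case: ifP => /eqP h hl; rewrite !mn_rcons; lia.
Qed.

Lemma mn_cut i j : (i < J)%N ->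
  mn [seq x.1 | x <- nth [::] cfg i] j = Posz (minn j (L i.+1)) + mn [seq x.1 | x <- cut i] j.
Proof.
by move=> iJ; rewrite -mn_cons; apply: mn_perm; apply: (perm_map (fun x : nat * int => x.1) (perm_cut iJ)).
Qed.

Lemma nth_new (F : nat -> seq (nat * int)) b :
  nth [::] (mkseq (fun i => if (i < J)%N then F i else nth [::] cfg i) (size cfg)) b =
  if (b < J)%N then F b else nth [::] cfg b.
Proof.
have [h|h] := ltnP b (size cfg); first by rewrite nth_mkseq.
rewrite !nth_default ?size_mkseq //; case: ltnP => // hb.
by have := J_le; rewrite -szcfg; lia.
Qed.

Lemma mn_tmp b j : mn (parts mu0' tmp b) j = mn (parts mu0 cfg b) j - gch b j.
Proof.
rewrite /parts; case: b => [|b] /=; first exact: mn_mu0'.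
rewrite /lens /= nth_new /gch; case: ltnP => bJ; last by rewrite subr0.
rewrite map_rcons mn_rcons mn_cut //; have := L_gt0 bJ.
by set l := L _; move: (l) => {}l /=; lia.
Qed.

(** A row of length 0 adds nothing to [mn], so discarding it changes no vacancy number. *)
Lemma mn_new b j : mn (parts mu0' cfg' b) j = mn (parts mu0 cfg b) j - gch b j.
Proof.
rewrite /parts; case: b => [|b] /=; first exact: mn_mu0'.
rewrite /lens /= nth_new /gch; case: ltnP => bJ; last by rewrite subr0.
have := L_gt0 bJ; case: ifP => /eqP h hL.
  by rewrite mn_cut //; set l := L _ in h hL *; move: (l) h hL => {}l /=; lia.
by rewrite map_rcons mn_rcons mn_cut //; set l := L _ in h hL *; move: (l) h hL => {}l /=; lia.
Qed.

Lemma vac_tmp a j : vac mu0' tmp a j =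
  vac mu0 cfg a j - gch a.-1 j + 2 * gch a j - gch a.+1 j.
Proof. by rewrite !vacE !mn_tmp; ring. Qed.

Lemma vac_new a j : vac mu0' cfg' a j =
  vac mu0 cfg a j - gch a.-1 j + 2 * gch a j - gch a.+1 j.
Proof. by rewrite !vacE !mn_new; ring. Qed.

(** Below [L i.+1] only the shortening in the preceding colour is visible, as chosen lengths
    increase weakly with the colour. *)
Lemma vac_tmp_cut i : (i < J)%N -> vac mu0' tmp i.+1 (L i.+1).-1 =
  vac mu0 cfg i.+1 (L i.+1).-1 - Posz (L i < L i.+1)%N.
Proof.
move=> iJ; have h := L_gt0 iJ; rewrite vac_tmp /= /gch iJ (ltnW iJ).
have -> : (L i.+1 <= (L i.+1).-1)%N = false by lia.
have -> : (L i <= (L i.+1).-1)%N = (L i < L i.+1)%N by lia.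
case: (ltnP i.+1 J) => h2; last by rewrite mulr0 addr0 subr0.
have [h3 _ _] := L_spec h2.
have -> : (L i.+2 <= (L i.+1).-1)%N = false by lia.
by rewrite mulr0 addr0 subr0.
Qed.

(** At the least zero [k] there is no row of colour [i.+1], since it would be singular and chosen
    earlier. Concavity at [k] then fails: strictly if [k = L i], a length present in colour [i], and
    otherwise because the vacancy number at [k.-1] is positive. *)
Lemma vac_gt0 i j : (i < J)%N -> (L i <= j < L i.+1)%N -> 0 < vac mu0 cfg i.+1 j.
Proof.
move=> iJ hj; have [le_L Lin nosing] := L_spec iJ.
have han : (0 < i.+1 <= n)%N by have := J_le; lia.
rewrite ltNge; apply/negP => neg.
have exP : exists j, (L i <= j < L i.+1)%N && (vac mu0 cfg i.+1 j <= 0) by exists j; rewrite hj.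
have [k /andP[hk kneg] kmin] := ex_minnP exP.
have v0 := vac_ge0 _ RC han.
have nl : k \notin parts mu0 cfg i.+1.
  apply/negP => /(mem_parts (isT : (0 < i.+1)%N))[r rin rk].
  case: RC => _ _ /(_ _ han _ rin) [_ r0 rv].
  have := nosing r rin; rewrite rk hk => /(_ isT) /eqP; apply.
  by rewrite rk in rv; have := v0 k; lia.
have L0 := L_gt0 (ltnW iJ).
have := vac_concave _ nl => /(_ ltac:(lia)) /= conc.
have := v0 k.+1; have := v0 k.-1; have := v0 k.
have [kL|kL] := eqVneq k (L i).
  have := cI_mem k k (L_mem (ltnW iJ)); rewrite /inI -kL.
  have -> : (k <= k <= k)%N by lia.
  by lia.
have := cI_ge0 k k (parts mu0 cfg i).
have := kmin k.-1; case: (lerP (vac mu0 cfg i.+1 k.-1) 0) => h; last by lia.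
by rewrite andbT; lia.
Qed.

Lemma RC_step : is_RC n mu0' cfg'.
Proof.
case: (RC) => sz mu0P rows; split.
- by rewrite size_mkseq.
- move: mu0P; rewrite /mu0 /mu0' all_rcons => /andP[h1 h2].
  by case: ifP => /eqP h //; rewrite all_rcons h2 andbT; lia.
case=> // i han x; rewrite /= nth_new vac_new /= => xin.
(* The vacancy number drops, by 1, only at lengths from [L i] up to but excluding [L i.+1] (without
   upper limit if [i = J]); rows there are not singular and have room for the drop. *)
have orig (y : nat * int) : y \in nth [::] cfg i ->
    [/\ (0 < y.1)%N, 0 <= y.2 & y.2 <= vac mu0 cfg i.+1 y.1 - gch i y.1 + 2 * gch i.+1 y.1 - gch i.+2 y.1].
  move=> yin; have [y0 r0 rv] := rows _ han _ yin; split=> //.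
  have mono b : (b < J)%N -> (L b <= L b.+1)%N by move=> /L_spec[].
  case: (ltnP i J) => iJ.
    have [_ _ ns] := L_spec iJ.
    have : ~~ (L i <= y.1 < L i.+1)%N || (y.2 != vac mu0 cfg i.+1 y.1).
      by case: (boolP (_ && _)) => //= h; apply: ns.
    have := mono i iJ; move: rv; rewrite /gch iJ (ltnW iJ) /=.
    by case: (ltnP i.+1 J) => [/mono|_] /=; lia.
  rewrite /gch; have -> : (i < J)%N = false by lia.
  have -> : (i.+1 < J)%N = false by lia.
  have [iE|iE] := eqVneq i J; last first.
    have -> : (i <= J)%N = false by lia.
    by rewrite /= mulr0 addr0 !subr0.
  have := @L_last y; rewrite -iE => last_ns; rewrite leqnn /=.
  case: leqP => h; rewrite /= mulr0 addr0 !subr0 //.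
  have := last_ns ltac:(lia) yin h; move: rv.
  by move: (vac _ _ _ _) y.2 => V z; lia.
move: xin; case: ltnP => iJ; last by move=> xin; exact: orig.
case: ifP => /eqP hL.
  by move=> /mem_rem xin; exact: orig.
rewrite mem_rcons inE => /orP[/eqP ->|/mem_rem xin] /=; last by exact: orig.
(* The shortened row is singular by construction; what remains is that its vacancy number is
   nonnegative. *)
rewrite -vac_tmp vac_tmp_cut //; split=> //; first by lia.
case: ltnP => h.
  have := @vac_gt0 i (L i.+1).-1 iJ; lia.
by rewrite subr0; apply: vac_ge0 RC _; lia.
Qed.

(** The output letter is [J.+1], so [d <= J] says that it exceeds [d]. *)
Lemma lens_step d : (0 < d)%N ->
  sumn (lens cfg d) = (sumn (lens cfg' d) + (d <= J))%N.
Proof.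
case: d => // i _; rewrite /lens /= nth_new; case: ltnP => iJ; last by rewrite addn0.
have := perm_sumn (perm_map (fun x : nat * int => x.1) (perm_cut iJ)) => /= ->.
have := L_gt0 iJ; case: ifP => /eqP hL h; first by lia.
by rewrite map_rcons sumn_rcons /=; lia.
Qed.

(** * Invariance of the tau functions under one step *)

(** A row shortened to length 0 is kept, with rigging 0, so that all colours move alike. *)
Let mv i : nat * int :=
  ((L i.+1).-1, vac mu0 cfg i.+1 (L i.+1).-1 - Posz (L i < L i.+1)%N).

(* Colours up to [m] after the step, the remaining ones before it. *)
Let hyb m : config :=
  mkseq (fun i => if (i < m)%N then mv i :: cut i else nth [::] cfg i) (size cfg).

Lemma nth_hyb m b : (m <= J)%N ->
  nth [::] (hyb m) b = if (b < m)%N then mv b :: cut b else nth [::] cfg b.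
Proof.
move=> mJ; have [h|h] := ltnP b (size cfg); first by rewrite nth_mkseq.
rewrite !nth_default ?size_mkseq //; case: ltnP => // hb.
by have := J_le; rewrite -szcfg; lia.
Qed.

Lemma cI_cons p q x l : cI p q (x :: l) = inI p q x + cI p q l.
Proof. by rewrite /cI big_cons. Qed.

Lemma cI_cut p q i : (i < J)%N ->
  cI p q (parts mu0 cfg i.+1) = inI p q (L i.+1) + cI p q [seq x.1 | x <- cut i].
Proof.
move=> iJ; rewrite -cI_cons /cI; apply: perm_big.
exact: (perm_map (fun x : nat * int => x.1) (perm_cut iJ)).
Qed.

Section Invariance.

Variables (M k d : nat).
Let lam := take k pre.
Hypothesis mu0M : all (fun x => x <= M)%N mu0.
Hypothesis cfgM : bounded M cfg.

(** An instance of the single row move: [v] and [Rm] refer to the configuration before the step,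
    whereas colour [m] of [hyb m] is already shortened. *)
Lemma hyb_succ m : (m < J)%N ->
  (forall phi, exists psi, dual n M d lam (hyb m.+1) psi <= dual n M d lam (hyb m) phi) /\
  (forall phi, exists psi, dual n M d lam (hyb m) psi <= dual n M d lam (hyb m.+1) phi).
Proof.
move=> mJ.
have an : (0 < m.+1 <= n)%N by have := J_le; lia.
have szh i : size (hyb i) = n by rewrite size_mkseq szcfg.
have permC : perm_eq (nth [::] (hyb m) m.+1.-1)
    ((L m.+1, vac mu0 cfg m.+1 (L m.+1)) :: cut m).
  by rewrite nth_hyb ?(ltnW mJ) //= ltnn perm_cut.
have permC' : perm_eq (nth [::] (hyb m.+1) m.+1.-1) (mv m :: cut m).
  by rewrite nth_hyb //= ltnSn.
have sameC b : b != m.+1.-1 -> nth [::] (hyb m.+1) b = nth [::] (hyb m) b.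
  move=> /= bm; rewrite !nth_hyb ?(ltnW mJ) //.
  by have -> : (b < m.+1)%N = (b < m)%N by lia.
have [le_L Lin ns] := L_spec mJ.
have hL : (0 < L m <= L m.+1)%N by rewrite le_L L_gt0 // ltnW.
have LM : (L m.+1 <= M)%N.
  by apply: (allP (cfgM m)); apply/mapP; eexists; first exact: Lin.
have v0 := vac0 mu0 cfg m.+1.
have vtop := vac_top m.+1 mu0M cfgM.
have vslope p q : (0 < p <= q)%N ->
   (vac mu0 cfg m.+1 p - vac mu0 cfg m.+1 p.-1) - (vac mu0 cfg m.+1 q.+1 - vac mu0 cfg m.+1 q) =
   cI p q (parts mu0 cfg m) - 2 * (cI p q [seq x.1 | x <- cut m] + inI p q (L m.+1))
   + cI p q (parts lam (hyb m) m.+2).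
  move=> pq; rewrite vac_slope // cI_cut // /= [inI _ _ _ + _]addrC; congr (_ + cI _ _ _).
  rewrite /parts /= /lens /= nth_hyb ?(ltnW mJ) //.
  by have -> : (m.+1 < m)%N = false by lia.
have Rmle p q : (0 < p <= q)%N -> cI p q (parts lam (hyb m) m.+1.-1) <=
   cI p q (parts mu0 cfg m) - inI p q (L m) + inI p q (L m).-1.
  (* For [m = 0] the preceding colour is [lam], which omits the processed row and possibly others of
     [pre]; hence only an inequality. *)
  move=> pq /=; move: mJ; case: (m) => [|i] iJ.
    have -> : parts mu0 cfg 0 = rcons pre l0 by [].
    have -> : cI p q (rcons pre l0) = cI p q lam + cI p q (drop k pre) + inI p q l0.
      by rewrite /cI -cats1 big_cat /= big_seq1 -{1}(cat_take_drop k pre) big_cat.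
    have -> : parts lam (hyb 0) 0 = lam by [].
    have -> : L 0 = l0 by [].
    have : 0 <= inI p q l0.-1 by [].
    by have := cI_ge0 p q (drop k pre); lia.
  rewrite cI_cut ?(ltnW iJ) // /parts /= /lens /= nth_hyb ?(ltnW iJ) // ltnSn /= cI_cons /=.
  by lia.
have restv x : x \in cut m -> x.2 <= vac mu0 cfg m.+1 x.1 - Posz (L m <= x.1 < L m.+1)%N.
  move=> /mem_rem xin; case: (RC) => _ _ /(_ _ an _ xin) [_ _].
  case h : (L m <= x.1 < L m.+1)%N; last by rewrite subr0.
  have := ns _ xin h; move: (vac _ _ _ _) x.2 => V z; lia.
split=> phi.
  exact: (dual_shorten_row d an (szh m) (szh m.+1) permC permC' sameC hL LM v0 vtop vslope Rmle restv).
exact: (dual_lengthen_row d an (szh m) (szh m.+1) permC permC' sameC hL LM v0 vtop vslope Rmle restv).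
Qed.

Lemma dual_hyb m : (m <= J)%N ->
  (forall phi, exists psi, dual n M d lam (hyb m) psi <= dual n M d lam cfg phi) /\
  (forall phi, exists psi, dual n M d lam cfg psi <= dual n M d lam (hyb m) phi).
Proof.
elim: m => [|m IH] mJ.
  by rewrite /hyb mkseq_nth; split=> phi; exists phi.
have [IH1 IH2] := IH (ltnW mJ); have [s1 s2] := hyb_succ mJ.
split=> phi.
  have [psi h] := IH1 phi; have [psi' h'] := s1 psi.
  by exists psi'; apply: le_trans h' h.
have [psi h] := s2 phi; have [psi' h'] := IH2 psi.
by exists psi'; apply: le_trans h' h.
Qed.

(** Up to order, [cfg'] and [hyb J] differ by rows of length 0, whose positive part is 0. *)
Lemma dual_new phi : dual n M d lam cfg' phi = dual n M d lam (hyb J) phi.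
Proof.
rewrite /dual; congr (_ + _); rewrite !posqE !size_mkseq; apply: eq_bigr => b _.
rewrite nth_new nth_hyb //; case: ltnP => bJ //; rewrite add0n big_cons /mv.
have L0 := L_gt0 bJ; case: ifP => /eqP hL.
  rewrite {1}/qe /= hL vac0 /=; have -> : (L b < L b.+1)%N = false.
    by have := L_gt0 (ltnW bJ); lia.
  by rewrite !subr0 /pos add0r.
by rewrite -cats1 big_cat /= big_seq1 addrC vac_tmp_cut.
Qed.

End Invariance.

Lemma bounded_step M : bounded M cfg -> bounded M cfg'.
Proof.
move=> cM a; rewrite nth_new; case: ltnP => aJ; last exact: cM.
have sub y : y \in cut a -> (y.1 <= M)%N.
  by move=> /mem_rem yin; apply: (allP (cM a)); apply: map_f.
have [_ Lin _] := L_spec aJ.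
have LM : (L a.+1 <= M)%N by apply: (allP (cM a)); apply/mapP; eexists; first exact: Lin.
case: ifP => _; apply/allP => _ /mapP[y + ->]; first exact: sub.
by rewrite mem_rcons inE => /orP[/eqP -> /=|/sub //]; lia.
Qed.

(** Both sides are minima of duals with the same constant [dualK M lam], and [dual_hyb] compares
    these minima in both directions. *)
Lemma tau_step k d : (0 < d <= n.+1)%N ->
  tau n cfg' (take k pre) d = tau n cfg (take k pre) d.
Proof.
move=> dn; have [M [mM cM]] := exists_bound mu0 cfg.
have lamM : all (fun x => x <= M)%N (take k pre).
  move: mM; rewrite all_rcons -{1}(cat_take_drop k pre) all_cat.
  by case/andP=> _ /andP[].
have cM' := bounded_step cM.
have sz' : size cfg' = n by rewrite size_mkseq szcfg.
have [h1 h2] := dual_hyb k d mM cM (leqnn J).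
apply/le_anti/andP; split.
  have [phi hphi] := dual_attained n0 szcfg dn lamM cM.
  have [psi hpsi] := h1 phi; apply: le_trans hphi.
  apply: le_trans (@tau_le_dual n M d _ cfg' psi n0 sz' dn lamM cM') _.
  by rewrite lerD2r dual_new.
have [phi hphi] := dual_attained n0 sz' dn lamM cM'.
move: hphi; rewrite dual_new // => hphi; have [psi hpsi] := h2 phi; apply: le_trans hphi.
apply: le_trans (@tau_le_dual n M d _ cfg psi n0 szcfg dn lamM cM) _.
by rewrite lerD2r.
Qed.

Lemma kkr_step_spec : exists j c',
  [/\ kkr_step n (rcons pre l0, cfg) =
        (j, (if l0.-1 == 0 then pre else rcons pre l0.-1, c')),
     is_RC n (if l0.-1 == 0 then pre else rcons pre l0.-1) c',
     (0 < j)%N,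
     forall d, (0 < d)%N -> sumn (lens cfg d) = (sumn (lens c' d) + (d < j))%N &
     forall k d, (0 < d <= n.+1)%N -> tau n c' (take k pre) d = tau n cfg (take k pre) d].
Proof.
exists J.+1, cfg'; split=> //; [exact: kkr_stepE|exact: RC_step| |].
  by move=> d d0; rewrite ltnS; exact: lens_step.
by move=> k d dn; exact: tau_step.
Qed.

End Step.

(** * Full prefixes, and assembly over the rows *)

Lemma tau_full n mu0 cfg d : (0 < n)%N -> is_RC n mu0 cfg -> (0 < d <= n.+1)%N ->
  tau n cfg mu0 d = tau_val n mu0 cfg d.
Proof.
move=> n0 RC dn; have [sz _ rows] := RC.
have [M [mM cM]] := exists_bound mu0 cfg.
apply/le_anti; rewrite tau_ge ?all_choices_self // andbT.
(* Its increments are the flow of the full choice, and the excess of a row is its vacancy number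
   minus its rigging, hence nonnegative: [posq] and [linq] agree. *)
pose phi : pot := fun a i => mn (parts mu0 cfg a) i - mn (parts mu0 cfg a.+1) i.
have evE a i : ev phi a i = mn (parts mu0 cfg a) i - mn (parts mu0 cfg a.+1) i.
  by case: i => [|i] //=; rewrite !mn0.
rewrite (@tau_val_eq n M d mu0 cfg phi) //; last first.
  by move=> a i i0; rewrite /dk !evE /ych -!mn_slope //; lia.
apply: le_trans (@tau_le_dual n M d mu0 cfg phi n0 sz dn mM cM) _.
rewrite lerD2r lerD2l posqE linqE; apply: ler_sum => b _.
rewrite big_seq [leRHS]big_seq; apply: ler_sum => x xin; rewrite add0n.
have han : (0 < b.+1 <= n)%N by rewrite -sz /= ltn_ord.
have [x0 _ xv] := rows _ han x xin.
have : qe b x phi = vac mu0 cfg b.+1 x.1 - x.2.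
  by rewrite /qe !evE vacE /=; lia.
by move=> ->; rewrite /pos; move: xv; move: (vac _ _ _ _) x.2 => V z; lia.
Qed.

Lemma tau_val_last n lam nu d : size nu = n ->
  tau_val n lam nu d = tau_val n lam nu n.+1 - Posz (sumn (lens nu d)).
Proof.
move=> sz; have E : lens nu n.+1 = [::] by rewrite /lens /= nth_default ?sz.
by rewrite /tau_val E subr0.
Qed.

Lemma kkr_runS n m st : kkr_run n m.+1 st =
  let: (j, st') := kkr_step n st in
  let: (js, st'') := kkr_run n m st' in (j :: js, st'').
Proof. by []. Qed.

Lemma kkr_run_spec n pre l cfg : (0 < n)%N -> is_RC n (rcons pre l) cfg ->
  exists ls c',
  [/\ kkr_run n l (rcons pre l, cfg) = (ls, (pre, c')), is_RC n pre c',
     (size ls = l) /\ all (leq 1) ls,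
     forall d, (0 < d)%N -> sumn (lens cfg d) = (sumn (lens c' d) + count (leq d.+1) ls)%N &
     forall k d, (0 < d <= n.+1)%N -> tau n c' (take k pre) d = tau n cfg (take k pre) d].
Proof.
move=> n0; elim: l cfg => [|l IH] cfg RC.
  by case: RC => _; rewrite all_rcons.
have [j [c1 [E1 RC1 j0 len1 tau1]]] := kkr_step_spec n0 RC.
(* A row of length 1 is gone after this step; a longer one is left to the induction. *)
rewrite kkr_runS E1; case: l IH RC E1 RC1 => [|l] IH RC E1 RC1.
  exists [:: j], c1; split=> //; first by rewrite /= j0.
  by move=> d d0; rewrite len1 //= addn0.
have [ls [c2 [E2 RC2 [sz2 pos2] len2 tau2]]] := IH c1 RC1.
rewrite E2.
exists (j :: ls), c2; split=> //.
- by rewrite /= sz2 j0.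
- by move=> d d0; rewrite len1 // len2 //=; lia.
- by move=> k d dn; rewrite tau2 // tau1.
Qed.

Lemma count_ltn_split (s : seq nat) d : (0 < d)%N ->
  count (leq d) s = (count (leq d.+1) s + count_mem d s)%N.
Proof.
by move=> d0; elim: s => //= x s ->; rewrite leq_eqVlt [d == x]eq_sym; case: eqVneq => [->|_] /=; lia.
Qed.

Theorem theorem2p1 (n : nat) (mu0 : seq nat) (cfg : config) :
  (1 <= n)%N -> is_RC n mu0 cfg ->
  forall k d, (1 <= k <= size mu0)%N -> (1 <= d <= n.+1)%N ->
  ((nth 0%N (nth [::] (KKR n mu0 cfg) k.-1) d.-1)%:Z
   = tau_kd n mu0 cfg k d - tau_kd n mu0 cfg k.-1 d
     - tau_kd n mu0 cfg k d.-1 + tau_kd n mu0 cfg k.-1 d.-1)%R.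
Proof.
(* Rows are processed from the last one, so the induction peels [mu0] from the right. *)
move=> n0; elim/last_ind: mu0 cfg => [|pre l IH] cfg RC k d hk hd; first by case: k hk.
have [ls [c' [E RC' [szls posls] len taueq]]] := kkr_run_spec n0 RC.
have KE : KKR n (rcons pre l) cfg =
    rcons (KKR n pre c') [seq count_mem d ls | d <- iota 1 n.+1].
  by rewrite /KKR size_rcons /= last_rcons E map_rcons.
have szK : size (KKR n pre c') = size pre.
  rewrite /KKR size_map; elim: (size pre) (pre, c') => //= m IHm st.
  by case: (kkr_run _ _ _) => js st'; rewrite size_rcons IHm.
rewrite KE nth_rcons szK; rewrite size_rcons in hk.
have takeE i : (i <= size pre)%N -> take i (rcons pre l) = take i pre.
  by move=> hi; rewrite -cats1 takel_cat.
have taukd i e : (i <= size pre)%N -> (e <= n.+1)%N ->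
    tau_kd n (rcons pre l) cfg i e = tau_kd n pre c' i e.
  by move=> hi he; rewrite /tau_kd takeE //; case: e he => [|e] he /=; rewrite taueq ?ltnSn.
have [kL|kL] := ltnP k.-1 (size pre).
  by rewrite !taukd; try lia; apply: IH => //; lia.
have -> : k = (size pre).+1 by lia.
rewrite succnK eqxx (nth_map 0%N) ?size_iota; last by lia.
rewrite nth_iota; last by lia.
have -> : (1 + d.-1)%N = d by lia.
have [sz _ _] := RC; have [sz' _ _] := RC'.
have top e : (0 < e <= n.+1)%N -> tau n cfg (take (size pre).+1 (rcons pre l)) e =
    tau_val n (rcons pre l) cfg n.+1 - Posz (sumn (lens cfg e)).
  by move=> he; rewrite -{1}(size_rcons pre l) take_size (tau_full n0 RC he) tau_val_last.
have low e : (0 < e <= n.+1)%N -> tau n cfg (take (size pre) (rcons pre l)) e =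
    tau_val n pre c' n.+1 - Posz (sumn (lens c' e)).
  move=> he; rewrite takeE // -taueq // take_size (tau_full n0 RC' he) tau_val_last //.
have cd : (0 < d)%N by lia.
have cnt_d := count_ltn_split ls cd.
(* For [d = 1] the term [tau_0] brings in the sizes of the prefixes, whose difference [l] is the
   number of letters output; for larger [d] only row sizes of two adjacent colours remain. *)
rewrite /tau_kd; case: d hd cd cnt_d => // -[|d] hd _ cnt_d /=.
  have hn : (0 < n.+1 <= n.+1)%N by lia.
  have lens0 c : size c = n -> lens c n.+1 = [::].
    by move=> szc; rewrite /lens /= nth_default ?szc.
  rewrite (top 1%N hd) (top _ hn) (low 1%N hd) (low _ hn) !lens0 // (len 1%N) //.
  rewrite (takeE (size pre)) // -(size_rcons pre l) !take_size sumn_rcons.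
  have : count (leq 1) ls = size ls by apply/eqP; rewrite -all_count.
  by rewrite cnt_d szls /=; lia.
have hd' : (0 < d.+1 <= n.+1)%N by lia.
by rewrite !(top _ hd) !(top _ hd') !(low _ hd) !(low _ hd') !len //; move: cnt_d => /=; lia.
Qed.
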